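(* For every $\alpha\ge 0$, write $L_{2\alpha+1}=\sum_{j\ge 1} l_j(2\alpha+1)G^j$. Then every coefficient $l_j(2\alpha+1)$ is an integer divisible by $5^{\alpha+1}$.
   Context: Let $(z;q)_\infty=\prod_{j\ge0}(1-zq^j)$. Define the power series $F=q\frac{(q;q)_\infty^3(q^{50};q^{50})_\infty^2}{(q^2;q^2)_\infty^2(q^{25};q^{25})_\infty^3}$ and $G=q\frac{(q;q)_\infty^2(q^{10};q^{10})_\infty^4}{(q^2;q^2)_\infty^4(q^5;q^5)_\infty^2}$ (i.e. $F=\eta(\tau)^3\eta(50\tau)^2/(\eta(2\tau)^2\eta(25\tau)^3)$, $G=\eta(\tau)^2\eta(10\tau)^4/(\eta(2\tau)^4\eta(5\tau)^2)$ with $q=e^{2\pi i\tau}$). The operator $U_5$ acts on power series by $\sum a(n)q^n\mid U_5=\sum a(5n)q^n$. Define $L_0=1$, and for $\alpha\ge 0$, $L_{2\alpha+1}=(FL_{2\alpha})\mid U_5$, $L_{2\alpha+2}=L_{2\alpha+1}\mid U_5$. Each $L_\nu$ with $\nu\ge1$ is a polynomial in $G$ with zero constant term (e.g. $L_1=5G$), and $l_j(\nu)$ denotes the coefficient of $G^j$ in $L_\nu$ (these coefficients are uniquely determined since $G$ is nonconstant). *)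

(* Defs.v *)
(* Formal power series in q with integer coefficients are
   represented as functions nat -> int (coefficient of q^n). *)
From HB Require Import structures.
From mathcomp Require Import all_boot all_order all_algebra.
Set Implicit Arguments. Unset Strict Implicit. Unset Printing Implicit Defensive.
Import Order.TTheory GRing.Theory Num.Theory.
Local Open Scope ring_scope.

Definition series := nat -> int.

Definition sone : series := fun n => (n == 0%N)%:R.

Definition smul (a b : series) : series :=
  fun n => \sum_(i < n.+1) a i * b (n - i)%N.

Definition spow (a : series) (k : nat) : series := iter k (smul a) sone.

Definition sq (a : series) : series :=
  fun n => if n is n'.+1 then a n' else 0.

(* (q^k;q^k)_oo : coefficient n computed from the finite product
   prod_{m=1}^{n} (1 - q^{k m}), which agrees with the infinite product
   modulo q^{n+1} for k >= 1. *)
Definition qpoch (k : nat) : series :=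
  fun n => (\prod_(1 <= m < n.+1) (1 - 'X^(k * m)) : {poly int})`_n.

(* 1/(q^k;q^k)_oo = prod_{m>=1} 1/(1-q^{km}) = prod_{m>=1} sum_{r>=0} q^{kmr};
   coefficient n computed from the truncation to m <= n, r <= n. *)
Definition qpochinv (k : nat) : series :=
  fun n => (\prod_(1 <= m < n.+1) \sum_(r < n.+1) 'X^(k * m * r) : {poly int})`_n.

Definition Fs : series :=
  sq (smul (spow (qpoch 1) 3)
     (smul (spow (qpoch 50) 2)
     (smul (spow (qpochinv 2) 2) (spow (qpochinv 25) 3)))).

Definition Gs : series :=
  sq (smul (spow (qpoch 1) 2)
     (smul (spow (qpoch 10) 4)
     (smul (spow (qpochinv 2) 4) (spow (qpochinv 5) 2)))).

Definition U5 (a : series) : series := fun n => a (5 * n)%N.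

Fixpoint L (nu : nat) : series :=
  match nu with
  | 0 => sone
  | m.+1 => if odd m then U5 (L m) else U5 (smul Fs (L m))
  end.

Definition peval (p : {poly int}) (g : series) : series :=
  fun n => \sum_(j < size p) p`_j * spow g j n.

(* Main.v *)
(* With psi(q) = sum_n q^(n(n+1)/2) = E(q^2)^2 / E(q), where E(q) = (q;q)_oo, one
   has G = q psi(q^5)^2 / psi(q)^2.  Gauss' formula for psi and Euler's
   pentagonal number theorem give the 5-dissections psi = a + b + c and
   E = e0 + e1 + e2, with c = q^3 psi(q^25) and e1 = - q E(q^25).  Splitting
   psi E = E(q^2)^2 by exponents mod 5 expresses x = a/c, y = b/c and
   rho = e2/e1 through k = rho(q) rho(q^2)^2, a series in q^5:
   x = rho^2 (1+k)/k, y = (1-k)/rho^2, rho^5 (1+k)^2 = k (1-k)^2.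
   The product of psi over q -> zeta q (zeta^5 = 1) then identifies
   H = G(q^5) with k/(1+k-k^2), and h = 1/(1+x+y) = c/psi satisfies a quintic
   over Z[H], while G = h^2/H and F = (1/rho - 1 - rho)^2 h.
   Hence the images under U_5 of the powers of h, with or without the factor
   (1/rho - 1 - rho)^2, obey a linear recurrence of order 5.  It starts from
   explicit Laurent polynomials at h^-4, ..., h^0 and shows that the
   coefficient of G^n is divisible by 5^((5n-j-1)/6) in G^j | U_5 and by
   5^((5n-j+2)/6) in F G^j | U_5 (exponents rounded down).  By induction
   l_j(2 alpha+1) and l_j(2 alpha+2) are divisible by
   5^(alpha+1+(5j-5)/6) and 5^(alpha+1+(5j-3)/6). *)
Require Import Defs.
From HB Require Import structures.
From mathcomp Require Import all_boot all_order all_algebra all_field.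
From mathcomp Require Import boolp zify ring.
Set Implicit Arguments. Unset Strict Implicit. Unset Printing Implicit Defensive.
Import Order.TTheory GRing.Theory Num.Theory.
Local Open Scope ring_scope.

(** * Formal power series *)

Record fps (R : Type) := Fps { coefs : nat -> R }.

HB.instance Definition _ (R : Type) := gen_eqMixin (fps R).
HB.instance Definition _ (R : Type) := gen_choiceMixin (fps R).

Notation "f `@ n" := (coefs f n) (at level 2, n at level 1, left associativity, format "f `@ n").

Lemma fpsP (R : Type) (f g : fps R) : (forall n, f`@n = g`@n) <-> f = g.
Proof.
split=> [|-> //]; case: f g => [f] [g] /= fg.
by congr Fps; apply: funext.
Qed.

Section FpsRing.
Variable R : comNzRingType.
Implicit Types f g h : fps R.

Definition fadd f g := Fps (fun n => f`@n + g`@n).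
Definition fopp f := Fps (fun n => - f`@n).
Definition fzero : fps R := Fps (fun=> 0).
Definition fone : fps R := Fps (fun n => (n == 0%N)%:R).
Definition fmul f g := Fps (fun n => \sum_(i < n.+1) f`@i * g`@(n - i)).

Fact faddA : associative fadd.
Proof. by move=> f g h; apply/fpsP => n /=; rewrite addrA. Qed.
Fact faddC : commutative fadd.
Proof. by move=> f g; apply/fpsP => n /=; rewrite addrC. Qed.
Fact fadd0 : left_id fzero fadd.
Proof. by move=> f; apply/fpsP => n /=; rewrite add0r. Qed.
Fact faddN : left_inverse fzero fopp fadd.
Proof. by move=> f; apply/fpsP => n /=; rewrite addNr. Qed.

HB.instance Definition _ := GRing.isZmodule.Build (fps R) faddA faddC fadd0 faddN.

Definition ftrunc (N : nat) f : {poly R} := \poly_(i < N) f`@i.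

(** Below degree [N] a product only sees the truncations of its factors, so commutativity and
    associativity of [fmul] are inherited from polynomials. *)
Lemma fmul_trunc N f g n : (n < N)%N ->
  (fmul f g)`@n = (ftrunc N f * ftrunc N g)`_n.
Proof.
move=> nN; rewrite coefM /=; apply: eq_bigr => i _.
rewrite !coef_poly (leq_ltn_trans _ nN) ?(leq_ltn_trans (leq_subr _ _) nN) //.
by rewrite -ltnS.
Qed.

Fact fmulC : commutative fmul.
Proof.
by move=> f g; apply/fpsP=> n; rewrite !(@fmul_trunc n.+1) // mulrC.
Qed.

Lemma trunc_fmul N f g n : (n < N)%N ->
  (ftrunc N (fmul f g))`_n = (ftrunc N f * ftrunc N g)`_n.
Proof. by move=> nN; rewrite coef_poly nN (fmul_trunc _ _ nN). Qed.

Fact fmulA : associative fmul.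
Proof.
move=> f g h; apply/fpsP=> n; rewrite !(@fmul_trunc n.+1) //.
rewrite coefM [RHS]coefM.
transitivity ((ftrunc n.+1 f * (ftrunc n.+1 g * ftrunc n.+1 h))`_n).
  rewrite coefM; apply: eq_bigr => i _; congr (_ * _).
  by rewrite trunc_fmul // ltnS leq_subr.
rewrite mulrA coefM; apply: eq_bigr => i _; congr (_ * _).
by rewrite trunc_fmul.
Qed.

Fact fmul1 : left_id fone fmul.
Proof.
move=> f; apply/fpsP=> n /=; rewrite big_ord_recl /= mul1r subn0 big1 ?addr0 //.
by move=> i _; rewrite mul0r.
Qed.

Fact fmulDl : left_distributive fmul fadd.
Proof.
move=> f g h; apply/fpsP=> n /=; rewrite -big_split /=.
by apply: eq_bigr => i _; rewrite mulrDl.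
Qed.

Fact fone_neq0 : fone != 0.
Proof.
by apply/eqP => /fpsP/(_ 0%N)/= /eqP; rewrite oner_eq0.
Qed.

HB.instance Definition _ :=
  GRing.Zmodule_isComNzRing.Build (fps R) fmulA fmulC fmul1 fmulDl fone_neq0.

Lemma coefs0 n : (0 : fps R)`@n = 0. Proof. by []. Qed.
Lemma coefs1 n : (1 : fps R)`@n = (n == 0%N)%:R. Proof. by []. Qed.
Lemma coefsD f g n : (f + g)`@n = f`@n + g`@n. Proof. by []. Qed.
Lemma coefsN f n : (- f)`@n = - f`@n. Proof. by []. Qed.
Lemma coefsB f g n : (f - g)`@n = f`@n - g`@n. Proof. by []. Qed.
Lemma coefsM f g n : (f * g)`@n = \sum_(i < n.+1) f`@i * g`@(n - i).
Proof. by []. Qed.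

Lemma coefs_sum (I : Type) (r : seq I) (P : pred I) (F : I -> fps R) n :
  (\sum_(i <- r | P i) F i)`@n = \sum_(i <- r | P i) (F i)`@n.
Proof. by elim/big_rec2: _ => [|i x y _ <-]. Qed.

Lemma coefsM0 f g : (f * g)`@0 = f`@0 * g`@0.
Proof. by rewrite coefsM big_ord_recl big_ord0 addr0. Qed.

End FpsRing.

Section FpsDomain.
Variable R : idomainType.
Implicit Types f g : fps R.

Definition funit : pred (fps R) := fun f => `[< exists g, g * f = 1 >].
Definition finv f := if pselect (exists g, g * f = 1) is left e then projT1 (cid e) else f.

Fact fmulV : {in funit, left_inverse 1 finv *%R}.
Proof. by move=> f /asboolP ff; rewrite /finv; case: pselect => // e; case: cid. Qed.
Fact funitP f g : g * f = 1 -> funit f.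
Proof. by move=> gf; apply/asboolP; exists g. Qed.
Fact finv_out : {in [predC funit], finv =1 id}.
Proof. by move=> f /asboolP ff; rewrite /finv; case: pselect. Qed.

HB.instance Definition _ :=
  GRing.ComNzRing_hasMulInverse.Build (fps R) fmulV funitP finv_out.

(** If [m] and [n] are the lowest nonzero indices, every other summand of the coefficient at [m + n]
    has a factor of too low index. *)
Fact fps_idomain f g : f * g = 0 -> (f == 0) || (g == 0).
Proof.
have ex f0 : f0 != 0 -> exists2 n, f0`@n != 0 & forall i, (i < n)%N -> f0`@i = 0.
  move=> nz; have ex : exists n, f0`@n != 0.
    apply: contrapT => /forallNP h; case/eqP: nz; apply/fpsP => n.
    by apply/eqP; apply: contrapT => hn; apply: (h n); apply/negP.
  case: (ex_minnP ex) => n nn mn; exists n => // i ni.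
  apply/eqP; apply: contraTT ni => hi; rewrite -leqNgt; exact: mn.
move=> fg; apply/negPn/negP; rewrite negb_or => /andP[/ex[m fm hm] /ex[n gn hn]].
move/fpsP/(_ (m + n)%N): fg; rewrite coefsM.
have lm : (m < (m + n).+1)%N by rewrite ltnS leq_addr.
rewrite (bigD1 (Ordinal lm)) //= big1 ?addr0 => [/eqP|i].
  by rewrite addKn mulf_eq0 (negPf fm) (negPf gn).
rewrite -val_eqE /= neq_ltn => /orP[/hm-> |mi]; first by rewrite mul0r.
rewrite hn ?mulr0 //.
by rewrite -(ltn_add2l i) subnKC ?ltn_add2r // -ltnS.
Qed.

HB.instance Definition _ := GRing.ComUnitRing_isIntegral.Build (fps R) fps_idomain.
End FpsDomain.

Lemma sum_multiples (V : nmodType) (k m : nat) (F : nat -> V) : (0 < k)%N ->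
  (forall i, ~~ (k %| i)%N -> F i = 0) ->
  \sum_(i < (k * m).+1) F i = \sum_(i < m.+1) F (k * i)%N.
Proof.
move=> k0 F0; elim: m => [|m IHm].
  by rewrite muln0 !big_ord_recl !big_ord0 /= muln0.
rewrite [RHS]big_ord_recr /= -IHm mulnS addnC -addSn big_split_ord /=; congr (_ + _).
case: k k0 F0 {IHm} => // k _ F0; rewrite big_ord_recr /= big1 ?add0r => [|i _].
  by congr F; lia.
apply: F0; rewrite addSn -addnS dvdn_addr ?dvdn_mulr //.
by rewrite gtnNdvd // ltnS.
Qed.

(** * The substitution q -> q^k, the operator U_5, and residue classes of exponents *)

Section Dilation.
Variable R : comNzRingType.
Implicit Types f g : fps R.

Definition fq : fps R := Fps (fun n => (n == 1%N)%:R).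

Lemma coefs_qM f n : (fq * f)`@n = if n is n'.+1 then f`@n' else 0.
Proof.
rewrite coefsM big_ord_recl /= mul0r add0r; case: n => [|n]; first by rewrite big_ord0.
rewrite big_ord_recl /= mul1r subSS subn0 big1 ?addr0 // => i _ /=.
by rewrite mul0r.
Qed.

Lemma coefs_qXM k f n :
  (fq ^+ k * f)`@n = if (n < k)%N then 0 else f`@(n - k).
Proof.
elim: k n => [|k IHk] n; first by rewrite mul1r subn0.
by rewrite exprS -mulrA coefs_qM; case: n.
Qed.

Lemma coefs_qX k n : (fq ^+ k)`@n = (n == k)%:R.
Proof.
rewrite -[_ ^+ _]mulr1 coefs_qXM; case: ltnP => nk; first by rewrite ltn_eqF.
by rewrite coefs1 subn_eq0 eqn_leq nk andbT.
Qed.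

(* The index is k.-1.+1 rather than k so that q |-> q^k is a ring morphism for every k; only k > 0 is meaningful. *)
Definition dil k f : fps R :=
  Fps (fun n => if (k.-1.+1 %| n)%N then f`@(n %/ k.-1.+1) else 0).

Lemma coefs_dil k f n :
  (dil k f)`@n = if (k.-1.+1 %| n)%N then f`@(n %/ k.-1.+1) else 0.
Proof. by []. Qed.

Lemma dil_is_zmod_morphism k : zmod_morphism (dil k).
Proof. by move=> f g; apply/fpsP => n /=; case: ifP; rewrite ?subr0. Qed.
HB.instance Definition _ k :=
  GRing.isZmodMorphism.Build (fps R) (fps R) (dil k) (dil_is_zmod_morphism k).

(** A series in q^k has only exponents divisible by [k]. This formula gives both the
    multiplicativity of [dil k] and the linearity of U_5 over series in q^5. *)
Lemma coefs_dilM k f g n : (0 < k)%N ->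
  (dil k f * g)`@(k * n) = \sum_(i < n.+1) f`@i * g`@(k * (n - i)).
Proof.
move=> k0; rewrite coefsM (@sum_multiples _ _ _
  (fun i => (dil k f)`@i * g`@(k * n - i))) // => [|i ki].
  by apply: eq_bigr => i _ /=; rewrite prednK // dvdn_mulr // mulKn // mulnBr.
by rewrite /= prednK // (negPf ki) mul0r.
Qed.

Lemma dil_is_monoid_morphism k : monoid_morphism (dil k).
Proof.
split=> [|f g]; apply/fpsP => n; rewrite coefs_dil.
  rewrite !coefs1; by case: n => [|n]; rewrite ?dvdn0 ?div0n //; case: ifP => // /dvdnP[[|d] ->//]; rewrite mulnK.
case: ifP => [/dvdnP[d ->]|dn].
  (* [dil k] and [dil e] are convertible and [e] is visibly positive, so [coefs_dilM] also covers
     [k = 0]. *)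
  set e := k.-1.+1.
  have -> : dil k f = dil e f by [].
  rewrite mulnK // mulnC coefs_dilM // coefsM.
  by apply: eq_bigr => i _ /=; rewrite dvdn_mulr // mulKn.
rewrite coefsM big1 // => i _ /=; case: ifP => // di; last by rewrite mul0r.
case: ifP => // dni; last by rewrite mulr0.
by rewrite -(@subnK i n) -1?ltnS // dvdn_add in dn.
Qed.
HB.instance Definition _ k :=
  GRing.isMonoidMorphism.Build (fps R) (fps R) (dil k) (dil_is_monoid_morphism k).

Lemma dil1 f : dil 1 f = f.
Proof. by apply/fpsP => n /=; rewrite dvd1n divn1. Qed.

Lemma dil_dil j k f : (0 < j)%N -> (0 < k)%N -> dil j (dil k f) = dil (j * k) f.
Proof.
move=> j0 k0; apply/fpsP => n /=; rewrite !prednK ?muln_gt0 ?j0 //.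
case: ifP => [/dvdnP[m ->]|jn].
  by rewrite mulnK // [(m * j)%N]mulnC dvdn_pmul2l // divnMl.
by case: ifP => // /(dvdn_trans (dvdn_mulr _ (dvdnn j))); rewrite jn.
Qed.

Lemma dil_q k : (0 < k)%N -> dil k fq = fq ^+ k.
Proof.
move=> k0; apply/fpsP => n; rewrite coefs_qX /= prednK //.
case: ifP => [/dvdnP[m ->]|kn]; first by rewrite mulnK // -{2}[k]mul1n eqn_pmul2r.
by case: eqP kn => // ->; rewrite dvdnn.
Qed.

Lemma dil_inj k : injective (dil k).
Proof.
move=> f g fg; apply/fpsP=> n; move/fpsP/(_ (k.-1.+1 * n)%N): fg => /=.
by rewrite dvdn_mulr // mulKn.
Qed.

Definition fU f : fps R := Fps (fun n => f`@(5 * n)).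

Lemma fUD f g : fU (f + g) = fU f + fU g. Proof. by []. Qed.

Lemma fUN f : fU (- f) = - fU f. Proof. by []. Qed.

Lemma fU_dilM f g : fU (dil 5 f * g) = f * fU g.
Proof. apply/fpsP => n; exact: (@coefs_dilM 5 f g n isT). Qed.

Lemma fU_dil f : fU (dil 5 f) = f.
Proof. rewrite -[dil 5 f]mulr1 fU_dilM [fU 1](_ : _ = 1) ?mulr1 //.
by apply/fpsP => -[|n] /=; rewrite ?muln0 ?mulnS. Qed.

Definition cls r f := forall n, n != r %[mod 5] -> f`@n = 0.

Lemma clsM r s f g : cls r f -> cls s g -> cls (r + s) (f * g).
Proof.
move=> cf cg n nrs; rewrite coefsM big1 // => i _.
have [ir|/cf->] := boolP (i == r %[mod 5]); last by rewrite mul0r.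
rewrite cg ?mulr0 //; apply: contra nrs => /eqP nis.
have iN : (i <= n)%N by rewrite -ltnS.
by rewrite -{1}(subnKC iN) -modnDm (eqP ir) nis modnDm.
Qed.

Lemma clsD r f g : cls r f -> cls r g -> cls r (f + g).
Proof. by move=> cf cg n nr; rewrite coefsD cf // cg // addr0. Qed.

Lemma clsMn r f m : cls r f -> cls r (f *+ m).
Proof. by move=> cf; elim: m => [|m IH]; [move=> n | rewrite mulrS; apply: clsD]. Qed.

Lemma cls_dil5 f : cls 0 (dil 5 f).
Proof. by move=> n n5 /=; case: ifP => //; rewrite /dvdn => /eqP n0; rewrite n0 in n5. Qed.

Lemma cls_qX k : cls k (fq ^+ k).
Proof. by move=> n nk; rewrite coefs_qX; case: (n =P k) nk => // ->; rewrite eqxx. Qed.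

Lemma cls_mod r s f : r = s %[mod 5] -> cls r f -> cls s f.
Proof. by rewrite /cls => ->. Qed.

Lemma cls_dil2 r f : cls r f -> cls (2 * r) (dil 2 f).
Proof.
move=> cf n n2; rewrite /=; case: ifP => // /dvdnP[m nm].
rewrite cf // nm mulnK //; apply: contra n2 => /eqP mr; rewrite nm mulnC.
by rewrite -modnMmr mr modnMmr.
Qed.

Definition proj r f : fps R := Fps (fun n => if n == r %[mod 5] then f`@n else 0).

Lemma proj_id r f : cls r f -> proj r f = f.
Proof. by move=> cf; apply/fpsP => n /=; case: ifPn => // /cf. Qed.

Lemma proj_other r s f : r != s %[mod 5] -> cls s f -> proj r f = 0.
Proof.
move=> rs cf; apply/fpsP => n /=; case: ifP => // /eqP nr.
by rewrite cf // nr.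
Qed.

Lemma projD r f g : proj r (f + g) = proj r f + proj r g.
Proof. by apply/fpsP => n /=; case: ifP; rewrite ?addr0. Qed.

Lemma cls_separate f0 f1 f2 f3 f4 g0 g1 g2 g3 g4 :
  cls 0 f0 -> cls 1 f1 -> cls 2 f2 -> cls 3 f3 -> cls 4 f4 ->
  cls 0 g0 -> cls 1 g1 -> cls 2 g2 -> cls 3 g3 -> cls 4 g4 ->
  f0 + f1 + f2 + f3 + f4 = g0 + g1 + g2 + g3 + g4 ->
  [/\ f0 = g0, f1 = g1, f2 = g2, f3 = g3 & f4 = g4].
Proof.
move=> F0 F1 F2 F3 F4 G0 G1 G2 G3 G4 E.
split; [have := congr1 (proj 0) E | have := congr1 (proj 1) E
  | have := congr1 (proj 2) E | have := congr1 (proj 3) E | have := congr1 (proj 4) E];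
  rewrite !projD.
- by rewrite !(proj_id F0, proj_id G0) (proj_other _ F1) ?(proj_other _ F2)
   ?(proj_other _ F3) ?(proj_other _ F4) ?(proj_other _ G1) ?(proj_other _ G2)
   ?(proj_other _ G3) ?(proj_other _ G4) // !addr0.
- by rewrite !(proj_id F1, proj_id G1) (proj_other _ F0) ?(proj_other _ F2)
   ?(proj_other _ F3) ?(proj_other _ F4) ?(proj_other _ G0) ?(proj_other _ G2)
   ?(proj_other _ G3) ?(proj_other _ G4) // !(addr0, add0r).
- by rewrite !(proj_id F2, proj_id G2) (proj_other _ F0) ?(proj_other _ F1)
   ?(proj_other _ F3) ?(proj_other _ F4) ?(proj_other _ G0) ?(proj_other _ G1)
   ?(proj_other _ G3) ?(proj_other _ G4) // !(addr0, add0r).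
- by rewrite !(proj_id F3, proj_id G3) (proj_other _ F0) ?(proj_other _ F1)
   ?(proj_other _ F2) ?(proj_other _ F4) ?(proj_other _ G0) ?(proj_other _ G1)
   ?(proj_other _ G2) ?(proj_other _ G4) // !(addr0, add0r).
- by rewrite !(proj_id F4, proj_id G4) (proj_other _ F0) ?(proj_other _ F1)
   ?(proj_other _ F2) ?(proj_other _ F3) ?(proj_other _ G0) ?(proj_other _ G1)
   ?(proj_other _ G2) ?(proj_other _ G3) // !(addr0, add0r).
Qed.

(** * Congruence modulo q^N *)

Definition eqm N f g := forall n, (n < N)%N -> f`@n = g`@n.

Lemma eqm_sym N f g : eqm N f g -> eqm N g f.
Proof. by move=> fg n nN; rewrite fg. Qed.
Lemma eqm_trans N g f h : eqm N f g -> eqm N g h -> eqm N f h.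
Proof. by move=> fg gh n nN; rewrite fg // gh. Qed.
Lemma eqm_leq M N f g : (N <= M)%N -> eqm M f g -> eqm N f g.
Proof. by move=> NM fg n nN; apply: fg; apply: leq_trans NM. Qed.
Lemma eqm_eq f g : (forall N, exists2 M, (N <= M)%N & eqm M f g) -> f = g.
Proof. by move=> fg; apply/fpsP => n; have [M nM] := fg n.+1; apply. Qed.

Lemma eqmD N f f' g g' : eqm N f f' -> eqm N g g' -> eqm N (f + g) (f' + g').
Proof. by move=> ff gg n nN; rewrite !coefsD ff // gg. Qed.

Lemma eqmM N f f' g g' : eqm N f f' -> eqm N g g' -> eqm N (f * g) (f' * g').
Proof.
move=> ff gg n nN; rewrite !coefsM; apply: eq_bigr => i _.
rewrite ff ?gg //; apply: leq_ltn_trans nN; first exact: leq_subr.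
by rewrite -ltnS.
Qed.

Lemma eqmX N f f' k : eqm N f f' -> eqm N (f ^+ k) (f' ^+ k).
Proof. by move=> ff; elim: k => // k IHk; rewrite !exprS; apply: eqmM. Qed.

Lemma eqm_prod N (I : Type) (r : seq I) (P : pred I) (F G : I -> fps R) :
  (forall i, P i -> eqm N (F i) (G i)) ->
  eqm N (\prod_(i <- r | P i) F i) (\prod_(i <- r | P i) G i).
Proof. by move=> FG; elim/big_rec2: _ => // i x y Pi; apply/eqmM/FG. Qed.

Lemma eqm_qX N k f : (N <= k)%N -> eqm N (fq ^+ k * f) 0.
Proof. by move=> Nk n nN; rewrite coefs_qXM (leq_trans nN Nk). Qed.

Lemma eqm_dil N k f g : (0 < k)%N -> eqm N f g -> eqm N (dil k f) (dil k g).
Proof.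
move=> k0 fg n nN /=; rewrite prednK //; case: ifP => // _; rewrite fg //.
exact: leq_ltn_trans (leq_div _ _) nN.
Qed.
End Dilation.
Arguments fq {R}.

(** * The theorems of Euler and Gauss *)

Fixpoint tri s := if s is s'.+1 then (tri s' + s)%N else 0%N.
(** Generalized pentagonal numbers m(3m-1)/2: [pent1 s] is the value at m = -s and [pent2 s] the
    value at m = s+1. *)
Fixpoint pent1 s := if s is s'.+1 then (pent1 s' + 3 * s' + 2)%N else 0%N.
Fixpoint pent2 s := if s is s'.+1 then (pent2 s' + 3 * s' + 4)%N else 1%N.

Lemma triE s : (2 * tri s = s * s.+1)%N.
Proof. elim: s => //= s IHs; nia. Qed.
Lemma pent1E s : (2 * pent1 s = s * (3 * s + 1))%N.
Proof. elim: s => //= s IHs; nia. Qed.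
Lemma pent2E s : (2 * pent2 s = s.+1 * (3 * s + 2))%N.
Proof. elim: s => //= s IHs; nia. Qed.

Section Theta.
Variable R : comNzRingType.
Local Notation q := (@fq R).

Definition poch M : fps R := \prod_(1 <= m < M.+1) (1 - q ^+ m).
Definition euler : fps R := Fps (fun n => (poch n)`@n).

Lemma eqm_poch M N : (N <= M)%N -> eqm N.+1 (poch M) (poch N).
Proof.
elim: M => [|M IHM]; first by rewrite leqn0 => /eqP ->.
rewrite leq_eqVlt => /orP[/eqP-> //|NM].
rewrite /poch big_nat_recr //= mulrBr mulr1 -[X in eqm _ _ X]addr0.
apply: eqmD; first exact: IHM.
rewrite mulrC -mulrN; exact: eqm_qX.
Qed.

Lemma eqm_euler M N : (N <= M)%N -> eqm N.+1 euler (poch M).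
Proof.
by move=> NM n nN /=; apply: eqm_sym (ltnSn n); apply: eqm_poch; apply: leq_trans NM.
Qed.

(** Infinite sum of a family with [F s] divisible by q^s, a condition that appears below as
    [eqm s (F s) 0]; only [s <= n] can then contribute to the coefficient of q^n. *)
Definition fsum (F : nat -> fps R) : fps R := Fps (fun n => \sum_(s < n.+1) (F s)`@n).

Lemma coefs_fsumE F n : (fsum F)`@n = \sum_(s < n.+1) (F s)`@n.
Proof. by []. Qed.

Lemma coefs_fsum F n M : (forall s, eqm s (F s) 0) -> (n < M)%N ->
  (fsum F)`@n = \sum_(s < M) (F s)`@n.
Proof.
move=> F0 nM; rewrite /= -(subnKC nM) big_split_ord /= [X in _ = _ + X]big1 ?addr0 // => i _.
by rewrite F0 // addSn ltnS leq_addr.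
Qed.

Lemma eqm_fsum F M : (forall s, eqm s (F s) 0) -> eqm M (fsum F) (\sum_(s < M) F s).
Proof. by move=> F0 n nM; rewrite coefs_sum (coefs_fsum F0 nM). Qed.

Lemma eq_fsum F G : F =1 G -> fsum F = fsum G.
Proof. by move=> FG; apply/fpsP=> n; apply: eq_bigr => i _; rewrite FG. Qed.

Lemma fsumN F : fsum (fun s => - F s) = - fsum F.
Proof. by apply/fpsP=> n; rewrite coefsN /= sumrN. Qed.

Lemma sum_mod5 (V : nmodType) (f : nat -> V) m :
  \sum_(s < 5 * m) f s = \sum_(t < m) (f (5 * t)%N + f (5 * t + 1)%N
    + f (5 * t + 2)%N + f (5 * t + 3)%N + f (5 * t + 4)%N).
Proof.
elim: m => [|m IHm]; first by rewrite muln0 !big_ord0.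
rewrite [RHS]big_ord_recr /= -IHm mulnS addnC big_split_ord /= !big_ord_recl big_ord0 /=.
by rewrite addn0 addr0 !addrA.
Qed.

Lemma fsum_dissect F : (forall s, eqm s (F s) 0) ->
  fsum F = fsum (fun t => F (5 * t)%N) + fsum (fun t => F (5 * t + 1)%N)
    + fsum (fun t => F (5 * t + 2)%N) + fsum (fun t => F (5 * t + 3)%N)
    + fsum (fun t => F (5 * t + 4)%N).
Proof.
move=> F0; apply/fpsP => n.
rewrite (@coefs_fsum _ _ (5 * n.+1)) //; last lia.
by rewrite (sum_mod5 (fun s => (F s)`@n)) !big_split.
Qed.

Lemma fsum_cls r F : (forall s, cls r (F s)) -> cls r (fsum F).
Proof. by move=> Fr n nr; rewrite /= big1 // => i _; rewrite Fr. Qed.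

Lemma fsum_qM k F : (forall s, eqm s (F s) 0) ->
  fsum (fun s => q ^+ k * F s) = q ^+ k * fsum F.
Proof.
move=> F0; apply/fpsP => n; rewrite coefs_qXM coefs_fsumE.
under eq_bigr do rewrite coefs_qXM.
case: ltnP => nk; first by rewrite big1.
by rewrite -(@coefs_fsum F) // ltnS leq_subr.
Qed.

Lemma dil_fsum k F : (0 < k)%N -> (forall s, eqm s (F s) 0) ->
  dil k (fsum F) = fsum (fun s => dil k (F s)).
Proof.
move=> k0 F0; apply/fpsP => n; rewrite coefs_dil prednK //.
rewrite [RHS]/=; case: ifP => kn.
  rewrite (@coefs_fsum F _ n.+1) // ?ltnS ?leq_div //.
  by apply: eq_bigr => i _; rewrite prednK // kn.
by rewrite big1 // => i _; rewrite prednK // kn.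
Qed.

Lemma eqm_sq s e k : (s <= e)%N -> eqm s ((-1) ^+ k * q ^+ e) (0 : fps R).
Proof. by move=> se; rewrite mulrC; apply: eqm_qX. Qed.

(** Telescoping in Shanks' proof of the pentagonal number theorem: replacing [M] by [M + 1] changes
    the partial sum up to [n] by one explicit term, found by induction on [n]. *)
Lemma shanks_pentagonal_step M n : (n <= M)%N ->
  let T N s : fps R := (-1) ^+ s * q ^+ (s * N + tri s) * \prod_(s.+1 <= m < N.+1) (1 - q ^+ m) in
  \sum_(s < n.+1) T M.+1 s = \sum_(s < n.+1) T M s
    - (-1) ^+ n * q ^+ (M.+1 + n * M.+1 + tri n) * \prod_(n.+1 <= m < M.+1) (1 - q ^+ m).
Proof.
move=> nM T; elim: n nM => [|n IHn] nM.
  rewrite !big_ord_recl !big_ord0 /T /= !mul0n !addn0 !expr0 !mul1r.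
  by rewrite big_nat_recr //=; ring.
rewrite big_ord_recr /= IHn 1?ltnW // [in RHS]big_ord_recr /= -!addrA; congr (_ + _).
rewrite /T [in LHS](@big_ltn _ _ _ n.+1) //.
rewrite (@big_nat_recr _ _ _ M.+1 n.+2) //=.
set Q := \prod_(n.+2 <= m < M.+1) _.
have -> : (M.+1 + n * M.+1 + tri n = n * M + tri n + (M + n + 1))%N by lia.
have -> : (n.+1 * M.+1 + (tri n + n.+1) = n * M + tri n + (M + n + n + 2))%N by lia.
have -> : (n.+1 * M + (tri n + n.+1) = n * M + tri n + (M + n + 1))%N by lia.
have -> : (M.+1 + n.+1 * M.+1 + (tri n + n.+1) = n * M + tri n + (M + M + n + n + 3))%N by lia.
rewrite !exprD !exprS; ring.
Qed.

Definition pentF1 s : fps R := (-1) ^+ s * q ^+ pent1 s.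
Definition pentF2 s : fps R := (-1) ^+ s.+1 * q ^+ pent2 s.

(** Shanks' finite pentagonal theorem. At [n = M] the correction of the telescoping step is the term
    of exponent [pent2 M], and the new summand [s = M + 1] is the one of exponent [pent1 M.+1]. *)
Lemma shanks_pentagonal M :
  \sum_(s < M.+1) ((-1) ^+ s * q ^+ (s * M + tri s) * \prod_(s.+1 <= m < M.+1) (1 - q ^+ m))
   = \sum_(s < M.+1) pentF1 s + \sum_(s < M) pentF2 s.
Proof.
elim: M => [|M IHM].
  by rewrite !big_ord_recl !big_ord0 /pentF1 /= big_geq // !addr0 mulr1.
rewrite big_ord_recr /= (shanks_pentagonal_step (leqnn M)) IHM.
rewrite big_geq //.
rewrite big_geq //.
rewrite [in RHS]big_ord_recr /=.
rewrite [\sum_(s < M.+1) pentF2 s]big_ord_recr /=.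
have -> : (M.+1 + M * M.+1 + tri M = pent2 M)%N by have := triE M; have := pent2E M; nia.
have -> : (M.+1 * M.+1 + (tri M + M.+1) = pent1 M.+1)%N
  by have := triE M; have := pent1E M.+1; nia.
rewrite /pentF1 /pentF2 /= !exprS; ring.
Qed.

Lemma leq_pent1 s : (s <= pent1 s)%N. Proof. elim: s => //=; lia. Qed.
Lemma leq_pent2 s : (s <= pent2 s)%N. Proof. elim: s => //=; lia. Qed.
Lemma leq_tri s : (s <= tri s)%N. Proof. elim: s => //=; lia. Qed.

Lemma eqm_pentF1 s : eqm s (pentF1 s) 0. Proof. exact/eqm_sq/leq_pent1. Qed.
Lemma eqm_pentF2 s : eqm s (pentF2 s) 0. Proof. exact/eqm_sq/leq_pent2. Qed.

Lemma euler_pentagonal : euler = fsum pentF1 + fsum pentF2.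
Proof.
apply: eqm_eq => N; exists N => //.
(* In Shanks' sum the term [s = 0] is [poch N]; all others are divisible by q^N. *)
apply: (@eqm_trans _ _ (\sum_(s < N.+1) ((-1) ^+ s * q ^+ (s * N + tri s) * \prod_(s.+1 <= m < N.+1) (1 - q ^+ m)))).
  apply: (@eqm_trans _ _ (poch N)); first exact: eqm_leq (leqnSn _) (eqm_euler (leqnn N)).
  rewrite big_ord_recl /= !mul1r -[X in eqm _ X]addr0; apply: eqmD => //.
  apply: eqm_sym => n nN; rewrite coefs_sum big1 // => i _.
  rewrite mulrAC mulrC; apply: (eqm_qX (N := N)) nN.
  rewrite /bump /=; nia.
rewrite shanks_pentagonal; apply: eqmD; apply: eqm_sym.
  by exact: eqm_leq (leqnSn _) (eqm_fsum eqm_pentF1).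
exact: eqm_fsum eqm_pentF2.
Qed.

(** * Gauss' formula for the sum of q^(s(s+1)/2) *)

Definition oddpoch M : fps R := \prod_(1 <= m < M.+1) (1 - q ^+ (2 * m).-1).

Lemma oddpochS M : oddpoch M.+1 = oddpoch M * (1 - q ^+ (2 * M).+1).
Proof.
have -> : ((2 * M).+1 = (2 * M.+1).-1)%N by lia.
by rewrite /oddpoch big_nat_recr.
Qed.

(** The same telescoping for triangular exponents; here the old partial sum is moreover multiplied
    by the new odd factor 1 - q^(2M+1). *)
Lemma shanks_triangular_step M n : (n <= M)%N ->
  let Q s N : fps R := \prod_(s.+1 <= m < N.+1) (1 - q ^+ (2 * m)) in
  \sum_(s < n.+1) Q s M.+1 * oddpoch s * q ^+ (s * (2 * M.+1).+1)
  = (1 - q ^+ (2 * M).+1) * \sum_(s < n.+1) Q s M * oddpoch s * q ^+ (s * (2 * M).+1)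
    + Q n M * oddpoch n.+1 * q ^+ (n.+1 * (2 * M).+1).
Proof.
move=> nM Q; elim: n nM => [|n IHn] nM.
  rewrite !big_ord_recl !big_ord0 /= oddpochS.
  rewrite /Q big_nat_recr //= /oddpoch (@big_geq _ _ _ 1 1) // !mul0n mul1n muln0 expr1 expr0.
  have -> : (2 * M.+1 = (2 * M).+1 + 1)%N by lia.
  by rewrite exprD; ring.
rewrite big_ord_recr /= IHn 1?ltnW // [in RHS]big_ord_recr /= !mulrDr -!addrA; congr (_ + _).
rewrite /Q [in LHS](@big_ltn _ _ _ n.+1) //.
rewrite (@big_nat_recr _ _ _ M.+1 n.+2) //= (oddpochS n.+1).
set QQ := \prod_(n.+2 <= m < M.+1) _.
have -> : (n.+1 * (2 * M.+1).+1 = n.+1 * (2 * M).+1 + (2 * n.+1))%N by lia.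
have -> : (n.+2 * (2 * M).+1 = n.+1 * (2 * M).+1 + (2 * M).+1)%N by lia.
have -> : (2 * M.+1 = (2 * M).+1 + 1)%N by lia.
rewrite !exprD !exprS; ring.
Qed.

(** Going from [M] to [M + 1], the last summand and the correction of the telescoping step supply
    the two new exponents M(2M+1) and (M+1)(2M+1), which are the triangular numbers of indices 2M
    and 2M+1. *)
Lemma shanks_triangular M :
  \sum_(s < M) \prod_(s.+1 <= m < M.+1) (1 - q ^+ (2 * m)) * oddpoch s * q ^+ (s * (2 * M).+1)
   = oddpoch M * \sum_(s < 2 * M) q ^+ tri s.
Proof.
elim: M => [|M IHM]; first by rewrite muln0 !big_ord0 mulr0.
rewrite (shanks_triangular_step (leqnn M)) big_ord_recr /= IHM.
have -> : (2 * M.+1 = (2 * M).+2)%N by lia.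
rewrite big_geq // mul1r !big_ord_recr /= oddpochS.
have -> : (M * (2 * M).+1 = tri (2 * M))%N by have := triE (2 * M); nia.
have -> : (M.+1 * (2 * M).+1 = tri (2 * M) + (2 * M).+1)%N by have := triE (2 * M); nia.
ring.
Qed.

Definition triF s : fps R := q ^+ tri s.
Definition psi := fsum triF.

Lemma eqm_triF s : eqm s (triF s) 0.
Proof. by rewrite /triF -[_ ^+ _]mulr1; apply/eqm_qX/leq_tri. Qed.

Lemma dil_poch k M : (0 < k)%N ->
  dil k (poch M) = \prod_(1 <= m < M.+1) (1 - q ^+ (k * m)).
Proof.
move=> k0; rewrite rmorph_prod /=; apply: eq_bigr => m _.
by rewrite rmorphB rmorph1 rmorphXn /= dil_q // exprM.
Qed.

Lemma poch_even_odd M : poch (2 * M) = dil 2 (poch M) * oddpoch M.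
Proof.
rewrite dil_poch //; elim: M => [|M IHM]; first by rewrite /poch /oddpoch !big_geq // mulr1.
rewrite oddpochS [in RHS]big_nat_recr //= mulrACA -IHM.
have -> : (2 * M.+1 = (2 * M).+2)%N by lia.
rewrite /poch [LHS]big_nat_recr //= [X in X * _ = _]big_nat_recr //=.
ring.
Qed.

Lemma gauss_triangular : psi * euler = dil 2 euler ^+ 2.
Proof.
apply: eqm_eq => N; exists N => //.
pose B := oddpoch N.
apply: (@eqm_trans _ _ ((\sum_(s < 2 * N) triF s) * poch (2 * N))).
  apply: eqmM.
    apply: (@eqm_leq _ (2 * N)); first lia.
    exact: eqm_fsum eqm_triF.
  by apply: (@eqm_leq _ N.+1) => //; apply: eqm_euler; lia.
(* One factor E(q^2) comes from the even part of [poch (2 * N)]. The odd part times the partial sum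
   of psi is Shanks' sum, which modulo q^N reduces to its term [s = 0], the second factor. *)
rewrite poch_even_odd mulrC -mulrA -shanks_triangular expr2.
apply: eqmM; first by apply: eqm_sym; apply: eqm_dil => //; exact: eqm_leq (leqnSn _) (eqm_euler (leqnn N)).
apply: eqm_sym.
apply: (@eqm_trans _ _ (dil 2 (poch N))).
  by apply: eqm_dil => //; exact: eqm_leq (leqnSn _) (eqm_euler (leqnn N)).
case: N @B => [|N] B //.
rewrite big_ord_recl /= /oddpoch (@big_geq _ _ _ 1 1) // mul0n expr0 !mulr1 -dil_poch //.
rewrite -[X in eqm _ X]addr0; apply: eqmD => //.
apply: eqm_sym => n nN; rewrite coefs_sum big1 // => i _.
rewrite mulrC; apply: (eqm_qX (N := N.+1)) nN.
rewrite /bump /=; nia.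
Qed.

End Theta.

(** * Dissections modulo 5 *)

Section Dissection.
Variable R : comNzRingType.
Local Notation q := (@fq R).

Lemma cls_signX k e : cls e ((-1) ^+ k * q ^+ e).
Proof. by move=> n ne; rewrite -signr_odd mulr_sign; case: odd; rewrite ?coefsN cls_qX ?oppr0. Qed.

Lemma cls_sign_eq r k e : e = r %[mod 5] -> cls r ((-1) ^+ k * q ^+ e).
Proof. by move=> er; apply: cls_mod er _; apply: cls_signX. Qed.

(** Only the indices 5t+2 give the residue 3, and there the triangular numbers reproduce themselves
    scaled by 25; this self-similarity produces the component q^3 psi(q^25). *)
Lemma tri_mod5 t : [/\ tri (5 * t) = 0 %[mod 5], tri (5 * t + 1) = 1 %[mod 5],
  tri (5 * t + 2) = (3 + 25 * tri t)%N, tri (5 * t + 3) = 1 %[mod 5]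
  & tri (5 * t + 4) = 0 %[mod 5]].
Proof.
have T := triE t; have T0 := triE (5 * t); have T1 := triE (5 * t + 1).
have T2 := triE (5 * t + 2); have T3 := triE (5 * t + 3); have T4 := triE (5 * t + 4).
by split; lia.
Qed.

(** The residue 1 arises only from [pent1] at 5t+4 and, in the companion lemma, from [pent2] at 5t.
    Scaled by 25, the two families are exchanged. *)
Lemma pent1_mod5 t : [/\ pent1 (5 * t) = 0 %[mod 5], pent1 (5 * t + 1) = 2 %[mod 5],
  pent1 (5 * t + 2) = 2 %[mod 5], pent1 (5 * t + 3) = 0 %[mod 5]
  & pent1 (5 * t + 4) = (1 + 25 * pent2 t)%N].
Proof.
have T := pent2E t; have T0 := pent1E (5 * t); have T1 := pent1E (5 * t + 1).
have T2 := pent1E (5 * t + 2); have T3 := pent1E (5 * t + 3); have T4 := pent1E (5 * t + 4).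
by split; lia.
Qed.

Lemma pent2_mod5 t : [/\ pent2 (5 * t) = (1 + 25 * pent1 t)%N, pent2 (5 * t + 1) = 0 %[mod 5],
  pent2 (5 * t + 2) = 2 %[mod 5], pent2 (5 * t + 3) = 2 %[mod 5]
  & pent2 (5 * t + 4) = 0 %[mod 5]].
Proof.
have T := pent1E t; have T0 := pent2E (5 * t); have T1 := pent2E (5 * t + 1).
have T2 := pent2E (5 * t + 2); have T3 := pent2E (5 * t + 3); have T4 := pent2E (5 * t + 4).
by split; lia.
Qed.

Lemma eqm_dil0 N k (f : fps R) : (0 < k)%N -> eqm N f 0 -> eqm N (dil k f) 0.
Proof. by move=> k0 f0; rewrite -(rmorph0 (dil k)); apply: eqm_dil. Qed.

Lemma dil_signX k s e : (0 < k)%N ->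
  dil k ((-1) ^+ s * q ^+ e) = (-1) ^+ s * q ^+ (k * e).
Proof. by move=> k0; rewrite rmorphM rmorph_sign rmorphXn /= dil_q // -exprM. Qed.

Lemma psi_dissection : exists a b : fps R,
  [/\ cls 0 a, cls 1 b & psi R = a + b + q ^+ 3 * dil 25 (psi R)].
Proof.
exists (fsum (fun t => triF R (5 * t)) + fsum (fun t => triF R (5 * t + 4))).
exists (fsum (fun t => triF R (5 * t + 1)) + fsum (fun t => triF R (5 * t + 3))).
split.
- apply: clsD; apply: fsum_cls => t; have [? ? ? ? ?] := tri_mod5 t;
    by rewrite /triF -[_ ^+ _]mul1r; apply: (@cls_sign_eq 0 0).
- apply: clsD; apply: fsum_cls => t; have [? ? ? ? ?] := tri_mod5 t;
    by rewrite /triF -[_ ^+ _]mul1r; apply: (@cls_sign_eq 1 0).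
rewrite {1}/psi (fsum_dissect (@eqm_triF R)) /psi dil_fsum //; last exact: eqm_triF.
rewrite -fsum_qM => [|s]; last exact/eqm_dil0/eqm_triF.
rewrite (@eq_fsum _ (fun t => triF R (5 * t + 2)) (fun s => q ^+ 3 * dil 25 (triF R s))) => [|t].
  ring.
have [_ _ + _ _] := tri_mod5 t.
by rewrite /triF => ->; rewrite rmorphXn /= dil_q // -exprM -exprD.
Qed.

Lemma euler_dissection : exists e0 e2 : fps R,
  [/\ cls 0 e0, cls 2 e2 & euler R = e0 - q * dil 25 (euler R) + e2].
Proof.
pose F1 := @pentF1 R; pose F2 := @pentF2 R.
exists (fsum (fun t => F1 (5 * t)%N) + fsum (fun t => F1 (5 * t + 3)%N)
   + fsum (fun t => F2 (5 * t + 1)%N) + fsum (fun t => F2 (5 * t + 4)%N)).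
exists (fsum (fun t => F1 (5 * t + 1)%N) + fsum (fun t => F1 (5 * t + 2)%N)
   + fsum (fun t => F2 (5 * t + 2)%N) + fsum (fun t => F2 (5 * t + 3)%N)).
split.
- by do 3?apply: clsD; apply: fsum_cls => t; have [? ? ? ? ?] := pent1_mod5 t;
    have [? ? ? ? ?] := pent2_mod5 t; apply: cls_sign_eq.
- by do 3?apply: clsD; apply: fsum_cls => t; have [? ? ? ? ?] := pent1_mod5 t;
    have [? ? ? ? ?] := pent2_mod5 t; apply: cls_sign_eq.
(* The parity of 5t+4 is that of t, whereas [pentF2 t] carries (-1)^(t+1): hence the minus sign in
   front of q E(q^25). *)
have E1 : fsum (fun t => F1 (5 * t + 4)%N) = - (q * dil 25 (fsum F2)).
  rewrite dil_fsum //; last exact: eqm_pentF2.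
  rewrite -[X in X * _]expr1 -fsum_qM => [|s]; last exact/eqm_dil0/eqm_pentF2.
  rewrite -fsumN; apply: eq_fsum => t; rewrite /F1 /F2 /pentF1 /pentF2.
  have [_ _ _ _ ->] := pent1_mod5 t.
  rewrite dil_signX // exprD expr1.
  rewrite exprD exprM (_ : (-1) ^+ 5 = -1) ?exprS; ring.
have E2 : fsum (fun t => F2 (5 * t)%N) = - (q * dil 25 (fsum F1)).
  rewrite dil_fsum //; last exact: eqm_pentF1.
  rewrite -[X in X * _]expr1 -fsum_qM => [|s]; last exact/eqm_dil0/eqm_pentF1.
  rewrite -fsumN; apply: eq_fsum => t; rewrite /F1 /F2 /pentF1 /pentF2.
  have [-> _ _ _ _] := pent2_mod5 t.
  rewrite dil_signX // exprD expr1.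
  rewrite (exprS _ (5 * t)) exprM (_ : (-1) ^+ 5 = -1); ring.
rewrite {1}euler_pentagonal (fsum_dissect (@eqm_pentF1 R)) (fsum_dissect (@eqm_pentF2 R)).
rewrite -/F1 -/F2 E1 E2 euler_pentagonal rmorphD /= -/F1 -/F2; ring.
Qed.

End Dissection.

Local Notation q := (@fq int).
Local Notation E := (euler int).
Local Notation Psi := (psi int).

(* Comparing the residue classes mod 5 of the exponents in psi * E = E(q^2)^2. *)
Lemma dissection_relations : exists e0 e2 a b : fps int,
  let e1 := - (q * dil 25 E) in let c := q ^+ 3 * dil 25 Psi in
  [/\ [/\ cls 0 e0, cls 2 e2, cls 0 a & cls 1 b],
      E = e0 + e1 + e2 /\ Psi = a + b + c, e0 * e2 = - e1 ^+ 2, c * e1 = - dil 2 e1 ^+ 2 &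
      [/\ a * e0 + c * e2 = dil 2 e0 ^+ 2, a * e1 + b * e0 = 2 * dil 2 e1 * dil 2 e2,
          a * e2 + b * e1 = 2 * dil 2 e0 * dil 2 e1 & b * e2 + c * e0 = dil 2 e2 ^+ 2]].
Proof.
have [e0 [e2 [c0 c2 Ee]]] := euler_dissection int.
have [a [b [ca cb Pe]]] := psi_dissection int.
exists e0, e2, a, b => e1 c.
have c1 : cls 1 e1.
  move=> n n1; rewrite coefsN /e1 -(@dil_dil _ 5 5) //.
  by rewrite (clsM (@cls_qX int 1) (cls_dil5 (dil 5 E))) ?oppr0.
have cc : cls 3 c.
  apply: (cls_mod (r := 3 + 0)) => //.
  by apply: clsM; [apply: cls_qX | rewrite -(@dil_dil _ 5 5) //; apply: cls_dil5].
(* This is Gauss' identity at q^25 multiplied by -q^4, since [dil 2 e1] is -q^2 E(q^50). *)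
have ce1 : c * e1 = - dil 2 e1 ^+ 2.
  rewrite /c /e1 rmorphN rmorphM /= dil_q // dil_dil // -[(2 * 25)%N]/(25 * 2)%N.
  rewrite -(@dil_dil _ 25 2) // sqrrN exprMn -rmorphXn /= -gauss_triangular rmorphM /=; ring.
have d0 : cls 0 (dil 2 e0) by apply: cls_mod (cls_dil2 c0).
have d1 : cls 2 (dil 2 e1) by apply: cls_mod (cls_dil2 c1).
have d2 : cls 4 (dil 2 e2) by apply: cls_mod (cls_dil2 c2).
have G := gauss_triangular int.
have [] := @cls_separate int (a * e0 + c * e2) (a * e1 + b * e0) (a * e2 + b * e1)
   (b * e2 + c * e0) (c * e1) (dil 2 e0 ^+ 2) ((dil 2 e1 * dil 2 e2) *+ 2)
   ((dil 2 e0 * dil 2 e1) *+ 2) (dil 2 e2 ^+ 2) (dil 2 e1 ^+ 2 + (dil 2 e0 * dil 2 e2) *+ 2).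
- by apply: clsD; [apply: cls_mod (clsM ca c0) | apply: cls_mod (clsM cc c2)].
- by apply: clsD; [apply: cls_mod (clsM ca c1) | apply: cls_mod (clsM cb c0)].
- by apply: clsD; [apply: cls_mod (clsM ca c2) | apply: cls_mod (clsM cb c1)].
- by apply: clsD; [apply: cls_mod (clsM cb c2) | apply: cls_mod (clsM cc c0)].
- by apply: cls_mod (clsM cc c1).
- by rewrite expr2; apply: cls_mod (clsM d0 d0).
- by apply: clsMn; apply: cls_mod (clsM d1 d2).
- by apply: clsMn; apply: cls_mod (clsM d0 d1).
- by rewrite expr2; apply: cls_mod (clsM d2 d2).
- by apply: clsD; [rewrite expr2; apply: cls_mod (clsM d1 d1) | apply: clsMn; apply: cls_mod (clsM d0 d2)].
- transitivity (Psi * E); first by rewrite [in RHS]Pe [in RHS]Ee -/c -/e1; ring.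
  rewrite G {1}Ee -/e1 !rmorphD /= -/e1; ring.
move=> G0 G1 G2 G3 G4; split=> //; last by split=> //; [rewrite G1 | rewrite G2]; ring.
(* Class 4 gives c e1 = d1^2 + 2 d0 d2, where d_i stands for e_i(q^2). With c e1 = -d1^2 it yields 2
   (d0 d2 + d1^2) = 0, and the claim follows since [dil 2] is injective and the integers have no
   torsion. *)
apply: (@dil_inj _ 2); apply/eqP; rewrite -subr_eq0.
have h : dil 2 (e0 * e2 - - e1 ^+ 2) *+ 2 = 0.
  rewrite rmorphB rmorphN rmorphM rmorphXn /=.
  have := G4; rewrite ce1 => G4'.
  transitivity (dil 2 e1 ^+ 2 + (dil 2 e0 * dil 2 e2) *+ 2 - - dil 2 e1 ^+ 2); first by ring.
  by rewrite -G4' subrr.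
rewrite -rmorphB; apply/eqP/fpsP => n; have /fpsP/(_ n) := h.
by rewrite mulr2n coefsD -mulr2n => /eqP; rewrite mulrn_eq0 => /eqP.
Qed.

(** * The norm over fifth roots of unity *)

Section Map.
Variables (R S : comNzRingType) (phi : {rmorphism R -> S}).

Definition fmap (f : fps R) : fps S := Fps (fun n => phi f`@n).

Lemma fmap_is_zmod_morphism : zmod_morphism fmap.
Proof. by move=> f g; apply/fpsP => n /=; rewrite rmorphB. Qed.
HB.instance Definition _ :=
  GRing.isZmodMorphism.Build (fps R) (fps S) fmap fmap_is_zmod_morphism.

Lemma fmap_is_monoid_morphism : monoid_morphism fmap.
Proof.
split=> [|f g]; apply/fpsP => n; first by rewrite /= rmorph_nat.
by rewrite coefsM /= rmorph_sum; apply: eq_bigr => i _; rewrite rmorphM.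
Qed.
HB.instance Definition _ :=
  GRing.isMonoidMorphism.Build (fps R) (fps S) fmap fmap_is_monoid_morphism.

Lemma fmap_dil k f : fmap (dil k f) = dil k (fmap f).
Proof. by apply/fpsP => n /=; case: ifP; rewrite ?rmorph0. Qed.

Lemma fmap_psi : fmap (psi R) = psi S.
Proof.
apply/fpsP => n /=; rewrite rmorph_sum; apply: eq_bigr => i _.
by rewrite /triF !coefs_qX rmorph_nat.
Qed.

Lemma cls_fmap r f : cls r f -> cls r (fmap f).
Proof. by move=> cf n nr /=; rewrite cf ?rmorph0. Qed.
End Map.

(** These are the two Gaussian periods of order 5. A product over conjugates paired as z^j, z^(5-j)
    involves only them, and in the end only their sum and product. *)
Lemma primitive_pair (A : comNzRingType) (z : A) : 1 + z + z ^+ 2 + z ^+ 3 + z ^+ 4 = 0 ->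
  ((z + z ^+ 4) + (z ^+ 2 + z ^+ 3) = -1) * ((z + z ^+ 4) * (z ^+ 2 + z ^+ 3) = -1).
Proof.
move=> z0; split; first by rewrite -[LHS]subr0 -z0; ring.
transitivity ((z ^+ 3 - z + 1) * (1 + z + z ^+ 2 + z ^+ 3 + z ^+ 4) - 1); first by ring.
by rewrite z0; ring.
Qed.

(** * The substitution q -> z q and the product over fifth roots of unity *)

Section Rotation.
Variable R : comNzRingType.
Implicit Types (f g : fps R) (z : R).

Definition fconst z : fps R := Fps (fun n => z *+ (n == 0%N)).

Lemma coefs_constM z f n : (fconst z * f)`@n = z * f`@n.
Proof.
rewrite coefsM big_ord_recl /= mulr1n subn0 big1 ?addr0 // => i _.
by rewrite mulr0n mul0r.
Qed.

Lemma fconst_is_zmod_morphism : zmod_morphism fconst.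
Proof. by move=> x y; apply/fpsP => n /=; rewrite mulrnBl. Qed.
HB.instance Definition _ :=
  GRing.isZmodMorphism.Build R (fps R) fconst fconst_is_zmod_morphism.

Lemma fconst_is_monoid_morphism : monoid_morphism fconst.
Proof.
split=> [|x y]; apply/fpsP => n; first by [].
by rewrite coefs_constM /= mulrnAr.
Qed.
HB.instance Definition _ :=
  GRing.isMonoidMorphism.Build R (fps R) fconst fconst_is_monoid_morphism.

Definition rot z f : fps R := Fps (fun n => z ^+ n * f`@n).

Lemma rot_is_zmod_morphism z : zmod_morphism (rot z).
Proof. by move=> f g; apply/fpsP => n /=; rewrite mulrBr. Qed.
HB.instance Definition _ z :=
  GRing.isZmodMorphism.Build (fps R) (fps R) (rot z) (rot_is_zmod_morphism z).

Lemma rot_is_monoid_morphism z : monoid_morphism (rot z).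
Proof.
split=> [|f g]; apply/fpsP => n.
  by rewrite /=; case: n => [|n]; rewrite ?mulr1 ?mulr0.
rewrite coefsM /= mulr_sumr; apply: eq_bigr => i _.
have iN : (i <= n)%N by rewrite -ltnS.
by rewrite mulrACA -exprD subnKC.
Qed.
HB.instance Definition _ z :=
  GRing.isMonoidMorphism.Build (fps R) (fps R) (rot z) (rot_is_monoid_morphism z).

Lemma rot_q z m : rot z (fq ^+ m) = fconst (z ^+ m) * fq ^+ m.
Proof.
apply/fpsP => n; rewrite coefs_constM /= coefs_qX.
by case: eqP => [->|] //; rewrite !mulr0.
Qed.

Lemma rot_cls z r f : z ^+ 5 = 1 -> cls r f -> rot z f = fconst (z ^+ r) * f.
Proof.
move=> z5 cf; apply/fpsP => n; rewrite coefs_constM /=.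
have [nr|/cf->] := boolP (n == r %[mod 5]); last by rewrite !mulr0.
by rewrite -(expr_mod n z5) (eqP nr) expr_mod.
Qed.

Lemma rot_dil2 z f : rot z (dil 2 f) = dil 2 (rot (z ^+ 2) f).
Proof.
apply/fpsP => n /=; case: ifP => [/dvdnP[m ->]|_]; last by rewrite mulr0.
by rewrite mulnK // -exprM mulnC.
Qed.

Lemma eqm_rot N z f g : eqm N f g -> eqm N (rot z f) (rot z g).
Proof. by move=> fg n nN /=; rewrite fg. Qed.

Definition norm5 z f := f * rot z f * rot (z ^+ 2) f * rot (z ^+ 3) f * rot (z ^+ 4) f.

Lemma norm5M z f g : norm5 z (f * g) = norm5 z f * norm5 z g.
Proof. by rewrite /norm5 !rmorphM /=; ring. Qed.

Lemma eqm_norm5 N z f g : eqm N f g -> eqm N (norm5 z f) (norm5 z g).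
Proof. by move=> fg; do 4![apply: eqmM; last exact: eqm_rot]. Qed.

(** Squaring permutes the exponents 0, ..., 4 of z modulo 5, so it only reorders the factors. *)
Lemma norm5_dil2 z f : z ^+ 5 = 1 -> norm5 z (dil 2 f) = dil 2 (norm5 z f).
Proof.
move=> z5; rewrite /norm5 !rot_dil2 -!exprM -(expr_mod (3 * 2) z5) -(expr_mod (4 * 2) z5).
by rewrite !rmorphM /= expr1; ring.
Qed.

(** The factors at z, z^4 and at z^2, z^3 multiply to p + s ab + t m and p + t ab + s m, with s, t
    the two periods; their product is symmetric in s and t. *)
Lemma norm5_psi_form z a b c : z ^+ 5 = 1 -> 1 + z + z ^+ 2 + z ^+ 3 + z ^+ 4 = 0 ->
  cls 0 a -> cls 1 b -> cls 3 c -> norm5 z (a + b + c)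
  = a ^+ 5 + b ^+ 5 + c ^+ 5 + 5 * a ^+ 2 * b ^+ 2 * c - 5 * a * b * c ^+ 3.
Proof.
move=> z5 z0 ca cb cc.
have zj j : (z ^+ j) ^+ 5 = 1 by rewrite -exprM mulnC exprM z5 expr1n.
rewrite /norm5 !rmorphD /= (rot_cls z5 ca) (rot_cls z5 cb) (rot_cls z5 cc).
rewrite !(rot_cls (zj _) ca) !(rot_cls (zj _) cb) !(rot_cls (zj _) cc).
rewrite -!exprM -(expr_mod (2 * 3) z5) -(expr_mod (3 * 3) z5) -(expr_mod (4 * 3) z5).
rewrite !muln0 !expr0 !muln1 !rmorph1 !expr1 !mul1r /= !rmorphXn.
set Z := fconst z.
have Z5 : Z ^+ 5 = 1 by rewrite -rmorphXn z5 rmorph1.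
have [s1 s2] : ((Z + Z ^+ 4) + (Z ^+ 2 + Z ^+ 3) = -1)
    * ((Z + Z ^+ 4) * (Z ^+ 2 + Z ^+ 3) = -1).
  apply: primitive_pair; transitivity (fconst (1 + z + z ^+ 2 + z ^+ 3 + z ^+ 4)).
    by rewrite !rmorphD rmorph1 !rmorphXn.
  by rewrite z0 rmorph0.
set s := Z + Z ^+ 4 in s1 s2; set t := Z ^+ 2 + Z ^+ 3 in s1 s2.
pose p := a ^+ 2 + b ^+ 2 + c ^+ 2; pose m := a * c + b * c.
have F14 : (a + Z * b + Z ^+ 3 * c) * (a + Z ^+ 4 * b + Z ^+ 2 * c) = p + s * (a * b) + t * m.
  (* Adding a multiple of Z^5 - 1 makes the equation a polynomial identity in Z; the relation Z^5 =
     1 is used only afterwards. *)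
  transitivity (p + s * (a * b) + t * m + (Z ^+ 5 - 1) * (b ^+ 2 + c ^+ 2 + Z ^+ 2 * b * c)).
    rewrite /p /s /t /m; ring.
  by rewrite Z5; ring.
have F23 : (a + Z ^+ 2 * b + Z * c) * (a + Z ^+ 3 * b + Z ^+ 4 * c) = p + t * (a * b) + s * m.
  transitivity (p + t * (a * b) + s * m + (Z ^+ 5 - 1) * (b ^+ 2 + c ^+ 2 + Z * b * c)).
    rewrite /p /s /t /m; ring.
  by rewrite Z5; ring.
transitivity ((a + b + c) * (((a + Z * b + Z ^+ 3 * c) * (a + Z ^+ 4 * b + Z ^+ 2 * c))
    * ((a + Z ^+ 2 * b + Z * c) * (a + Z ^+ 3 * b + Z ^+ 4 * c)))); first by ring.
rewrite F14 F23.
transitivity ((a + b + c) * (p ^+ 2 + p * (s + t) * (a * b + m)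
   + (s * t) * ((a * b) ^+ 2 + m ^+ 2) + ((s + t) ^+ 2 - 2 * (s * t)) * (a * b * m))); first by ring.
rewrite s1 s2 /p /m; ring.
Qed.

Lemma norm5_one_sub z m : z ^+ 5 = 1 -> 1 + z ^+ m + (z ^+ m) ^+ 2 + (z ^+ m) ^+ 3 + (z ^+ m) ^+ 4 = 0 ->
  norm5 z (1 - fq ^+ m) = 1 - fq ^+ (5 * m).
Proof.
move=> z5 w0; rewrite /norm5 !rmorphB !rmorph1 /= !rot_q -!exprM.
rewrite -[(2 * m)%N]mulnC -[(3 * m)%N]mulnC -[(4 * m)%N]mulnC [(5 * m)%N]mulnC !exprM.
have : (z ^+ m) ^+ 5 = 1 by rewrite -exprM mulnC exprM z5 expr1n.
move: (z ^+ m) w0 => w w0 w5; rewrite !rmorphXn; set Z := fconst w; set Q := fq ^+ m.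
have [s1 s2] : ((Z + Z ^+ 4) + (Z ^+ 2 + Z ^+ 3) = -1)
    * ((Z + Z ^+ 4) * (Z ^+ 2 + Z ^+ 3) = -1).
  apply: primitive_pair; transitivity (fconst (1 + w + w ^+ 2 + w ^+ 3 + w ^+ 4)).
    by rewrite !rmorphD rmorph1 !rmorphXn.
  by rewrite w0 rmorph0.
have Z5 : Z ^+ 5 = 1.
  by rewrite -rmorphXn w5 rmorph1.
set s := Z + Z ^+ 4 in s1 s2; set t := Z ^+ 2 + Z ^+ 3 in s1 s2.
have F14 : (1 - Z * Q) * (1 - Z ^+ 4 * Q) = 1 - s * Q + Q ^+ 2.
  transitivity (1 - s * Q + Q ^+ 2 + (Z ^+ 5 - 1) * Q ^+ 2); first by rewrite /s; ring.
  by rewrite Z5; ring.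
have F23 : (1 - Z ^+ 2 * Q) * (1 - Z ^+ 3 * Q) = 1 - t * Q + Q ^+ 2.
  transitivity (1 - t * Q + Q ^+ 2 + (Z ^+ 5 - 1) * Q ^+ 2); first by rewrite /t; ring.
  by rewrite Z5; ring.
transitivity ((1 - Q) * (((1 - Z * Q) * (1 - Z ^+ 4 * Q)) * ((1 - Z ^+ 2 * Q) * (1 - Z ^+ 3 * Q)))).
  ring.
rewrite F14 F23.
transitivity ((1 - Q) * (1 - (s + t) * Q * (1 + Q ^+ 2) + (2 + s * t) * Q ^+ 2 + Q ^+ 4)); first by ring.
rewrite s1 s2; ring.
Qed.

Lemma norm5_one_sub5 z m : z ^+ 5 = 1 -> norm5 z (1 - fq ^+ (5 * m)) = (1 - fq ^+ (5 * m)) ^+ 5.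
Proof.
move=> z5; have R1 j : rot (z ^+ j) (1 - fq ^+ (5 * m)) = 1 - fq ^+ (5 * m).
  rewrite rmorphB rmorph1 /= rot_q -exprM mulnCA exprM z5 expr1n rmorph1 mul1r //.
by rewrite /norm5 -{1}[z]expr1 !R1; ring.
Qed.
End Rotation.

Section NormC.
Local Notation C := algC.
Local Notation q := (@fq C).

Lemma primitive5 : exists2 z : C, z ^+ 5 = 1 &
  forall m, ~~ (5 %| m)%N -> 1 + z ^+ m + (z ^+ m) ^+ 2 + (z ^+ m) ^+ 3 + (z ^+ m) ^+ 4 = 0.
Proof.
have [z pz] := C_prim_root_exists (isT : (0 < 5)%N).
have z5 := prim_expr_order pz; exists z => // m m5; set w := z ^+ m.
have w1 : w - 1 != 0 by rewrite subr_eq0 /w -(prim_order_dvd pz).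
apply: (mulfI w1); rewrite mulr0.
transitivity (w ^+ 5 - 1); first by ring.
by rewrite /w -exprM mulnC exprM z5 expr1n subrr.
Qed.

(** A factor with 5 not dividing m has norm 1 - q^(5m); one with 5 dividing m is merely raised to
    the fifth power. Multiplying by [dil 25 (poch C M)] completes the former to a full product in
    q^5. *)
Lemma norm5_poch (z : C) M : z ^+ 5 = 1 ->
  (forall m, ~~ (5 %| m)%N -> 1 + z ^+ m + (z ^+ m) ^+ 2 + (z ^+ m) ^+ 3 + (z ^+ m) ^+ 4 = 0) ->
  norm5 z (poch C (5 * M)) * dil 25 (poch C M)
  = dil 5 (poch C M) ^+ 5 * dil 5 (poch C (5 * M)).
Proof.
move=> z5 z0.
have pochS N : poch C N.+1 = poch C N * (1 - q ^+ N.+1) by rewrite /poch big_nat_recr.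
have dil1q k m : (0 < k)%N -> dil k (1 - q ^+ m) = 1 - q ^+ (k * m).
  by move=> k0; rewrite rmorphB rmorph1 rmorphXn /= dil_q // exprM.
elim: M => [|M IHM].
  by rewrite muln0 /poch big_geq // /norm5 !rmorph1 !mulr1 expr1n.
have -> : (5 * M.+1 = (5 * M).+4.+1)%N by lia.
rewrite !pochS !norm5M !rmorphM /= !dil1q //.
have N1 i : (0 < i < 5)%N -> norm5 z (1 - q ^+ (5 * M + i)) = 1 - q ^+ (5 * (5 * M + i)).
  by move=> i5; apply: norm5_one_sub => //; apply: z0; lia.
have -> : ((5 * M).+1 = 5 * M + 1)%N by lia.
have -> : (5 * M + 1).+1 = (5 * M + 2)%N by lia.
have -> : (5 * M + 2).+1 = (5 * M + 3)%N by lia.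
have -> : (5 * M + 3).+1 = (5 * M + 4)%N by lia.
rewrite !N1 //; have -> : (5 * M + 4).+1 = (5 * M.+1)%N by lia.
rewrite norm5_one_sub5 // mulnA.
transitivity ((norm5 z (poch C (5 * M)) * dil 25 (poch C M)) * ((1 - q ^+ (5 * (5 * M + 1))) *
  (1 - q ^+ (5 * (5 * M + 2))) * (1 - q ^+ (5 * (5 * M + 3))) *
  (1 - q ^+ (5 * (5 * M + 4))) * (1 - q ^+ (5 * M.+1)) ^+ 5 * (1 - q ^+ (25 * M.+1)))).
  clear; move: (norm5 z (poch C (5 * M))) (dil 25 (poch C M)) => x y; ring.
rewrite IHM; have -> : (25 * M.+1 = 5 * (5 * M.+1))%N by lia.
ring.
Qed.

Lemma norm5_euler (z : C) : z ^+ 5 = 1 ->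
  (forall m, ~~ (5 %| m)%N -> 1 + z ^+ m + (z ^+ m) ^+ 2 + (z ^+ m) ^+ 3 + (z ^+ m) ^+ 4 = 0) ->
  norm5 z (euler C) * dil 25 (euler C) = dil 5 (euler C) ^+ 6.
Proof.
move=> z5 z0; apply: eqm_eq => N; exists N => //.
have E1 : eqm N (euler C) (poch C N) by exact: eqm_leq (leqnSn _) (eqm_euler C (leqnn N)).
have E5 : eqm N (euler C) (poch C (5 * N)).
  by apply: (@eqm_leq _ N.+1) => //; apply: eqm_euler; lia.
apply: (@eqm_trans _ _ (norm5 z (poch C (5 * N)) * dil 25 (poch C N))).
  by apply: eqmM; [apply: eqm_norm5 | apply: eqm_dil].
rewrite norm5_poch // [_ ^+ 6]exprSr; apply: eqmM; first by apply: eqmX; apply: eqm_dil => //; apply: eqm_sym.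
by apply: eqm_dil => //; apply: eqm_sym.
Qed.

Lemma euler_neq0 (R : comNzRingType) : euler R != 0.
Proof. by apply/eqP => /fpsP/(_ 0%N)/eqP; rewrite /= /poch big_geq //= oner_eq0. Qed.

Lemma dil_neq0 (R : comNzRingType) k (f : fps R) : f != 0 -> dil k f != 0.
Proof. by apply: contraNneq => f0; apply/eqP/(@dil_inj _ k); rewrite f0 rmorph0. Qed.

(** By Gauss, psi = E(q^2)^2 / E, and the norm is multiplicative and commutes with q -> q^2, so
    [norm5_euler] at q and at q^2 suffices. Division is replaced by cancelling E(q^5)^6 E(q^25). *)
Lemma norm5_psi (z : C) : z ^+ 5 = 1 ->
  (forall m, ~~ (5 %| m)%N -> 1 + z ^+ m + (z ^+ m) ^+ 2 + (z ^+ m) ^+ 3 + (z ^+ m) ^+ 4 = 0) ->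
  norm5 z (psi C) * dil 25 (psi C) = dil 5 (psi C) ^+ 6.
Proof.
move=> z5 z0; have NE := norm5_euler z5 z0.
have G := gauss_triangular C.
have G5 : dil 5 (psi C) * dil 5 (euler C) = dil 10 (euler C) ^+ 2.
  by have := congr1 (dil 5) G; rewrite rmorphM rmorphXn /= dil_dil.
have G25 : dil 25 (psi C) * dil 25 (euler C) = dil 50 (euler C) ^+ 2.
  by have := congr1 (dil 25) G; rewrite rmorphM rmorphXn /= dil_dil.
have NG : norm5 z (psi C) * norm5 z (euler C) = dil 2 (norm5 z (euler C)) ^+ 2.
  by have := congr1 (norm5 z) G; rewrite expr2 !norm5M norm5_dil2.
have NE2 : dil 2 (norm5 z (euler C)) * dil 50 (euler C) = dil 10 (euler C) ^+ 6.
  by have := congr1 (dil 2) NE; rewrite rmorphM rmorphXn /= !dil_dil.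
have nz : dil 5 (euler C) ^+ 6 * dil 25 (euler C) != 0.
  by rewrite mulf_neq0 ?expf_neq0 ?dil_neq0 ?euler_neq0.
apply: (mulIf nz).
transitivity (norm5 z (psi C) * dil 5 (euler C) ^+ 6 * (dil 25 (psi C) * dil 25 (euler C))); first by ring.
rewrite G25 -NE.
transitivity ((norm5 z (psi C) * norm5 z (euler C)) * dil 25 (euler C) * (dil 50 (euler C) ^+ 2)); first by ring.
rewrite NG.
transitivity ((dil 2 (norm5 z (euler C)) * dil 50 (euler C)) ^+ 2 * dil 25 (euler C)); first by ring.
rewrite NE2 NE.
transitivity ((dil 10 (euler C) ^+ 2) ^+ 6 * dil 25 (euler C)); first by ring.
rewrite -G5; ring.
Qed.
End NormC.

Lemma fmap_inj (R S : idomainType) (phi : {rmorphism R -> S}) : injective phi -> injective (fmap phi).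
Proof. by move=> pI f g /fpsP fg; apply/fpsP => n; apply: pI; have := fg n. Qed.

Lemma psi_norm_form (a b c : fps int) : cls 0 a -> cls 1 b -> cls 3 c -> psi int = a + b + c ->
  (a ^+ 5 + b ^+ 5 + c ^+ 5 + 5 * a ^+ 2 * b ^+ 2 * c - 5 * a * b * c ^+ 3) * dil 25 (psi int)
  = dil 5 (psi int) ^+ 6.
Proof.
move=> ca cb cc Pe; have [z z5 z0] := primitive5.
have := norm5_psi z5 z0.
have zz : 1 + z + z ^+ 2 + z ^+ 3 + z ^+ 4 = 0 by have := z0 1%N isT; rewrite expr1.
pose phi : {rmorphism int -> algC} := intr.
rewrite -(fmap_psi phi) {1}Pe !rmorphD /=.
rewrite (norm5_psi_form z5 zz (cls_fmap phi ca) (cls_fmap phi cb) (cls_fmap phi cc)).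
rewrite -!fmap_dil => h.
apply: (@fmap_inj _ _ phi); first exact: intr_inj.
rewrite [RHS]rmorphXn /= -h rmorphM; congr (_ * _).
by rewrite rmorphB !rmorphD !(rmorphXn, rmorphM) /= !rmorph_nat.
Qed.

(** * Algebraic consequences of the dissections *)

Ltac field_nz := field; repeat (apply/andP; split); rewrite ?oppr_eq0 ?expf_neq0 //.

Section FieldAlgebra.
Variable K : fieldType.
Implicit Types k x y h u w rho sigma : K.

(** The relations of classes 0 and 3 determine a and b in terms of rho, sigma and c; those of
    classes 1 and 2 then force the equation between rho and k. *)
Lemma dissection_parametrization (e0 e1 e2 d0 d1 d2 a b c : K) :
  e1 != 0 -> e2 != 0 -> d1 != 0 -> d2 != 0 ->
  e0 * e2 = - e1 ^+ 2 -> d0 * d2 = - d1 ^+ 2 -> c * e1 = - d1 ^+ 2 ->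
  a * e0 + c * e2 = d0 ^+ 2 -> a * e1 + b * e0 = 2 * d1 * d2 ->
  a * e2 + b * e1 = 2 * d0 * d1 -> b * e2 + c * e0 = d2 ^+ 2 ->
  let rho := e2 / e1 in let sigma := d2 / d1 in let k := rho * sigma ^+ 2 in
  [/\ a / c = rho ^+ 2 * (1 + k) / k, b / c = (1 - k) / rho ^+ 2,
      rho ^+ 5 * (1 + k) ^+ 2 = k * (1 - k) ^+ 2 & e0 + e1 + e2 = e1 * (1 + rho - rho^-1)].
Proof.
move=> e1n e2n d1n d2n He Hd Hc H0 H1 H2 H3 rho sigma k.
have rn : rho != 0 by rewrite mulf_neq0 ?invr_neq0.
have sn : sigma != 0 by rewrite mulf_neq0 ?invr_neq0.
have kn : k != 0 by rewrite mulf_neq0 ?expf_neq0.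
have E2 : e2 = e1 * rho by rewrite /rho; field_nz.
have D2 : d2 = d1 * sigma by rewrite /sigma; field_nz.
have E0 : e0 = - e1 / rho by apply: (mulIf e2n); rewrite He /rho; field_nz.
have D0 : d0 = - d1 / sigma by apply: (mulIf d2n); rewrite Hd /sigma; field_nz.
have C : c = - d1 ^+ 2 / e1 by apply: (mulIf e1n); rewrite Hc; field_nz.
have cn : c != 0 by rewrite C mulf_neq0 ?invr_neq0 ?oppr_eq0 ?expf_neq0.
have X : a / c = rho ^+ 2 * (1 + k) / k.
  have e0n : e0 != 0 by rewrite E0 mulf_neq0 ?invr_neq0 ?oppr_eq0.
  have -> : a = (d0 ^+ 2 - c * e2) / e0 by rewrite -H0; field_nz.
  rewrite C D0 E0 E2 /k; field_nz.
have Y : b / c = (1 - k) / rho ^+ 2.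
  have -> : b = (d2 ^+ 2 - c * e0) / e2 by rewrite -H3; field_nz.
  rewrite C D2 E0 E2 /k; field_nz.
split=> //; last by rewrite {1}E0 {1}E2; field_nz.
have A1 : rho ^+ 5 * (1 + k) / k - (1 - k) = - 2 * sigma * rho ^+ 3.
  transitivity ((a * e1 + b * e0) / (c * e1) * rho ^+ 3).
    transitivity ((a / c + b / c * (e0 / e1)) * rho ^+ 3); last by field_nz.
    rewrite X Y E0; field_nz.
  rewrite H1 Hc D2; field_nz.
have A2 : rho ^+ 5 * (1 + k) / k + (1 - k) = 2 * rho ^+ 2 / sigma.
  transitivity ((a * e2 + b * e1) / (c * e1) * rho ^+ 2).
    transitivity ((a / c * (e2 / e1) + b / c) * rho ^+ 2); last by field_nz.
    rewrite X Y E2; field_nz.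
  rewrite H2 Hc D0; field_nz.
(* In [A1] plus k times [A2] the right-hand sides cancel, because k = rho sigma^2. *)
transitivity (k * ((1 - k) ^+ 2 + (rho ^+ 5 * (1 + k) / k - (1 - k)) + k * (rho ^+ 5 * (1 + k) / k + (1 - k)))).
  by field_nz.
rewrite A1 A2 /k; field_nz.
Qed.

(** x^5 + y^5 is a polynomial in x + y = w - 1 and xy = u - 1. *)
Lemma quintic x y u : u = x * y + 1 ->
  u ^+ 3 = 1 + x ^+ 5 + y ^+ 5 + 5 * x ^+ 2 * y ^+ 2 - 5 * x * y ->
  let w := 1 + x + y in
  w ^+ 5 - 5 * w ^+ 4 + (15 - 5 * u) * w ^+ 3 + (15 * u - 25) * w ^+ 2
    + (25 - 25 * u + 5 * u ^+ 2) * w = u ^+ 3.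
Proof. by move=> hu -> w; rewrite hu /w; ring. Qed.

(** The quintic at u = 1/H, multiplied by h^5 H^3 to clear the denominators. *)
Lemma h_recurrence x y H : H != 0 -> 1 + x + y != 0 -> H^-1 = x * y + 1 ->
  H^-1 ^+ 3 = 1 + x ^+ 5 + y ^+ 5 + 5 * x ^+ 2 * y ^+ 2 - 5 * x * y ->
  let h := (1 + x + y)^-1 in
  h ^+ 5 = H ^+ 3 - 5 * H ^+ 3 * h + (15 * H ^+ 3 - 5 * H ^+ 2) * h ^+ 2
   + (15 * H ^+ 2 - 25 * H ^+ 3) * h ^+ 3
   + (25 * H ^+ 3 - 25 * H ^+ 2 + 5 * H) * h ^+ 4.
Proof.
move=> Hn wn u1 u3 h; have := quintic u1 u3; rewrite /h.
set w := 1 + x + y in wn * => /= Q.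
apply: (mulfI (expf_neq0 5 wn)); apply: (mulfI (expf_neq0 3 (invr_neq0 Hn))).
transitivity (H^-1 ^+ 3); first by field_nz.
rewrite -{1}Q; field_nz.
Qed.

(** * Coordinates on the powers of rho and the class-0 parts of powers of w *)

Section Decomposition.
Variables (V N : K -> Prop) (rho k : K).
Hypothesis V1 : V 1.
Hypothesis VB : forall s t, V s -> V t -> V (s - t).
Hypothesis VM : forall s t, V s -> V t -> V (s * t).
Hypothesis VV : forall s, V s -> V s^-1.
Hypothesis Vk : V k.
Hypothesis ND : forall f g, N f -> N g -> N (f + g).
Hypothesis NZ : forall t f, V t -> N f -> N (t * f).
Hypothesis Nrho : forall e, (0 < e < 5)%N -> N (rho ^+ e).
Hypotheses (rn : rho != 0) (kn : k != 0) (k1 : 1 + k != 0) (k2 : 1 - k != 0).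
Hypothesis kH : 1 + k - k ^+ 2 != 0.
Hypothesis rho5 : rho ^+ 5 * (1 + k) ^+ 2 = k * (1 - k) ^+ 2.

Let x := rho ^+ 2 * (1 + k) / k.
Let y := (1 - k) / rho ^+ 2.
(** In the application [w] is psi / (q^3 psi(q^25)), [m] is E / (q E(q^25)) and [r] is rho^5. *)
Let w := 1 + x + y.
Let m := rho^-1 - 1 - rho.
Let r := k * (1 - k) ^+ 2 / (1 + k) ^+ 2.

Let V0 : V 0. Proof. by rewrite -(subrr 1); apply: VB. Qed.
Let VN s : V s -> V (- s). Proof. by move=> Vs; rewrite -(sub0r s); apply: VB. Qed.
Let VD s t : V s -> V t -> V (s + t).
Proof. by move=> Vs Vt; rewrite -[t]opprK; apply/VB/VN. Qed.
Let VX s n : V s -> V (s ^+ n).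
Proof. by move=> Vs; elim: n => // n IHn; rewrite exprS; apply: VM. Qed.
Let Vnat n : V n%:R.
Proof. by elim: n => // n IHn; rewrite -addn1 natrD; apply: VD. Qed.

(** [V] stands for the fractions in q^5 and [N] for the elements without class-0 part. As rho, ...,
    rho^4 lie in [N], the coordinate [t0] is what remains modulo [N]. *)
Definition decomposed (f t0 t1 t2 t3 t4 : K) :=
  [/\ V t0, V t1, V t2, V t3 & V t4]
  /\ f = t0 + t1 * rho + t2 * rho ^+ 2 + t3 * rho ^+ 3 + t4 * rho ^+ 4.

Lemma decomposed_mod f t0 t1 t2 t3 t4 : decomposed f t0 t1 t2 t3 t4 -> N (f - t0).
Proof.
move=> [[? ? ? ? ?] ->].
have -> : t0 + t1 * rho + t2 * rho ^+ 2 + t3 * rho ^+ 3 + t4 * rho ^+ 4 - t0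
  = t1 * rho ^+ 1 + t2 * rho ^+ 2 + t3 * rho ^+ 3 + t4 * rho ^+ 4 by ring.
by do 3?apply: ND; apply: NZ => //; apply: Nrho.
Qed.

Let rho5r : rho ^+ 5 = r.
Proof. by apply: (mulIf (expf_neq0 2 k1)); rewrite rho5 /r; field_nz. Qed.
Let r_neq0 : r != 0. Proof. by rewrite -rho5r expf_neq0. Qed.
Let Vr : V r.
Proof. by rewrite /r; apply: VM; [apply: VM => // | apply: VV]; apply: VX; [apply: VB | apply: VD]. Qed.
Let Va : V ((1 + k) / k). Proof. by apply: VM; [apply: VD | apply: VV]. Qed.
Let Vb : V (1 - k). Proof. exact: VB. Qed.

(** Since w = 1 + al rho^2 + (be / r) rho^3 and rho^5 = r, multiplication by w is an explicit linear
    map on coordinates. *)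
Lemma decomposed_mulw f t0 t1 t2 t3 t4 : decomposed f t0 t1 t2 t3 t4 ->
  let al := (1 + k) / k in let be := 1 - k in
  decomposed (w * f) (t0 + al * r * t3 + be * t2) (t1 + al * r * t4 + be * t3)
    (t2 + al * t0 + be * t4) (t3 + al * t1 + be / r * t0) (t4 + al * t2 + be / r * t1).
Proof.
move=> [[? ? ? ? ?] ->] al be; split.
  by split; repeat first [assumption | apply: VD | apply: VM | apply: VV].
have E1 : x = al * rho ^+ 2 by rewrite /x /al; field_nz.
have E2 : y = be / r * rho ^+ 3 by rewrite /y /be -rho5r; field_nz.
have E3 : be / r * r = be by field_nz.
rewrite /w E1 E2.
transitivity (t0 + t1 * rho + t2 * rho ^+ 2 + t3 * rho ^+ 3 + t4 * rho ^+ 4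
  + al * (t0 * rho ^+ 2 + t1 * rho ^+ 3 + t2 * rho ^+ 4 + rho ^+ 5 * (t3 + t4 * rho))
  + be / r * (t0 * rho ^+ 3 + t1 * rho ^+ 4)
  + be / r * rho ^+ 5 * (t2 + t3 * rho + t4 * rho ^+ 2)); first by ring.
rewrite rho5r E3; ring.
Qed.

Lemma decomposed1 : decomposed 1 1 0 0 0 0.
Proof. by split; [split | ring]. Qed.

Lemma decomposed_m2 : decomposed (m ^+ 2) (- 1) 2 1 r^-1 (- 2 / r).
Proof.
split; first by split; rewrite ?mulNr; repeat first [assumption | exact: Vnat | apply: VN | apply: VM | apply: VV].
by rewrite /m -rho5r; field_nz.
Qed.

Let H := k / (1 + k - k ^+ 2).

Lemma decomposed_eq f t0 t1 t2 t3 t4 s : decomposed f t0 t1 t2 t3 t4 ->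
  t0 = s -> N (f - s).
Proof. by move=> D <-; apply: decomposed_mod D. Qed.

Lemma w_powers : [/\ N (w ^+ 4 - (6 / H ^+ 2 - 5)), N (w ^+ 3 - (6 / H - 5)),
  N (w ^+ 2 - (2 / H - 1)), N (w - 1) & N (1 - 1)].
Proof.
have D0 := decomposed1; have D1 := decomposed_mulw D0; have D2 := decomposed_mulw D1.
have D3 := decomposed_mulw D2; have D4 := decomposed_mulw D3.
rewrite !mulr1 in D1 D2 D3 D4; rewrite -?exprS -?expr2 in D2 D3 D4.
split.
- have -> : w ^+ 4 = w * (w * (w * w)) by ring.
  apply: (decomposed_eq D4); rewrite /H /r; field_nz.
- have -> : w ^+ 3 = w * (w * w) by ring.
  apply: (decomposed_eq D3); rewrite /H /r; field_nz.
- have -> : w ^+ 2 = w * w by ring.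
  apply: (decomposed_eq D2); rewrite /H /r; field_nz.
- apply: (decomposed_eq D1); ring.
- exact: decomposed_mod D0.
Qed.

Lemma m2_w_powers : [/\ N (m ^+ 2 * w ^+ 4 + 25), N (m ^+ 2 * w ^+ 3 - (1 / H ^+ 2 + 5 / H - 25)),
  N (m ^+ 2 * w ^+ 2 + 5), N (m ^+ 2 * w - 1 / H) & N (m ^+ 2 + 1)].
Proof.
have D0 := decomposed_m2; have D1 := decomposed_mulw D0; have D2 := decomposed_mulw D1.
have D3 := decomposed_mulw D2; have D4 := decomposed_mulw D3.
split.
- have -> : m ^+ 2 * w ^+ 4 + 25 = w * (w * (w * (w * m ^+ 2))) - (- 25) by ring.
  apply: (decomposed_eq D4); rewrite /H /r; field_nz.
- have -> : m ^+ 2 * w ^+ 3 = w * (w * (w * m ^+ 2)) by ring.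
  apply: (decomposed_eq D3); rewrite /H /r; field_nz.
- have -> : m ^+ 2 * w ^+ 2 + 5 = w * (w * m ^+ 2) - (- 5) by ring.
  apply: (decomposed_eq D2); rewrite /H /r; field_nz.
- have -> : m ^+ 2 * w = w * m ^+ 2 by ring.
  apply: (decomposed_eq D1); rewrite /H /r; field_nz.
- by have := decomposed_mod D0; rewrite opprK.
Qed.

End Decomposition.
End FieldAlgebra.

(** * 5-adic bounds along the recurrence *)

(* The index i stands for h^(i-4) and the coefficient n for H^(n-2), which
   keeps the negative powers of h and H needed below in range. *)
Definition good c i (p : {poly int}) := forall n,
  ((2 * n + 1 < i)%N -> p`_n = 0) /\ ((5 ^ ((5 * n + c - 3 * i) %/ 6))%:Z %| p`_n)%Z.

Lemma goodD c i p1 p2 : good c i p1 -> good c i p2 -> good c i (p1 + p2).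
Proof.
move=> g1 g2 n; have [z1 d1] := g1 n; have [z2 d2] := g2 n; rewrite coefD.
by split=> [ni|]; [rewrite z1 ?z2 | exact: rpredD].
Qed.

Lemma good_monomial c i i' j b (a : int) p :
  (forall n, (j <= n)%N -> (2 * n + 1 < i)%N -> (2 * (n - j) + 1 < i')%N) ->
  (forall n, (j <= n)%N -> ((5 * n + c - 3 * i) %/ 6 <= b + (5 * (n - j) + c - 3 * i') %/ 6)%N) ->
  ((5 ^ b)%:Z %| a)%Z -> good c i' p -> good c i (a *: ('X^j * p)).
Proof.
move=> hz hd ab gp n; rewrite coefZ coefXnM; case: (ltnP n j) => [_|jn].
  by rewrite mulr0 dvdz0.
have [pz pd] := gp (n - j)%N; split=> [ni|]; first by rewrite pz ?mulr0 ?hz.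
apply: (@dvdz_trans ((5 ^ (b + (5 * (n - j) + c - 3 * i') %/ 6))%:Z)).
  by apply: dvdn_exp2l; apply: hd.
by rewrite expnD PoszM; apply: dvdz_mul.
Qed.

(* The coefficients are those of the quintic equation of [h_recurrence]. *)
Definition recurrence_step (p0 p1 p2 p3 p4 : {poly int}) : {poly int} :=
  1 *: ('X^3 * p0) + -5 *: ('X^3 * p1) + 15 *: ('X^3 * p2) + -5 *: ('X^2 * p2)
  + 15 *: ('X^2 * p3) + -25 *: ('X^3 * p3) + 25 *: ('X^3 * p4) + -25 *: ('X^2 * p4)
  + 5 *: ('X^1 * p4).

(** A term a H^j taken from d places back raises 5n - 3i by 5j - 3d. In each of the nine terms the
    5-adic valuation of a is at least (5j - 3d)/6, and d <= 2j keeps the low coefficients zero. *)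
Lemma good_step c i p0 p1 p2 p3 p4 : good c i p0 -> good c i.+1 p1 -> good c i.+2 p2 ->
  good c i.+3 p3 -> good c i.+4 p4 -> good c i.+4.+1 (recurrence_step p0 p1 p2 p3 p4).
Proof.
move=> g0 g1 g2 g3 g4; rewrite /recurrence_step.
do 8?[apply: goodD].
- by apply: (good_monomial (b := 0) _ _ _ g0) => // n ?; lia.
- by apply: (good_monomial (b := 1) _ _ _ g1) => // n ?; lia.
- by apply: (good_monomial (b := 1) _ _ _ g2) => // n ?; lia.
- by apply: (good_monomial (b := 1) _ _ _ g2) => // n ?; lia.
- by apply: (good_monomial (b := 1) _ _ _ g3) => // n ?; lia.
- by apply: (good_monomial (b := 2) _ _ _ g3) => // n ?; lia.
- by apply: (good_monomial (b := 2) _ _ _ g4) => // n ?; lia.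
- by apply: (good_monomial (b := 2) _ _ _ g4) => // n ?; lia.
- by apply: (good_monomial (b := 1) _ _ _ g4) => // n ?; lia.
Qed.

(** Turns [good] into a finite computation for the ten explicit starting polynomials. *)
Lemma goodP c i (s : seq int) :
  all (fun n => ((2 * n + 1 < i)%N ==> (s`_n == 0)) &&
    ((5 ^ ((5 * n + c - 3 * i) %/ 6))%:Z %| s`_n)%Z) (iota 0 (size s)) ->
  good c i (Poly s).
Proof.
move=> /allP h n; rewrite coef_Poly; have [ns|ns] := ltnP n (size s); last first.
  by rewrite nth_default // dvdz0.
have /andP[/implyP h1 h2] : _ := h n ltac:(by rewrite mem_iota).
by split=> // /h1/eqP.
Qed.

Section PolyValue.
Variable K : comNzRingType.
Implicit Types (H h f : K).

Definition pval (p : {poly int}) H : K := (map_poly intr p).[H].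

Lemma pvalD p1 p2 H : pval (p1 + p2) H = pval p1 H + pval p2 H.
Proof. by rewrite /pval rmorphD hornerD. Qed.
Lemma pvalZXn a j p H : pval (a *: ('X^j * p)) H = a%:~R * H ^+ j * pval p H.
Proof. by rewrite /pval linearZ rmorphM /= map_polyXn hornerZ hornerM hornerXn mulrA. Qed.

Lemma pval_step p0 p1 p2 p3 p4 H : pval (recurrence_step p0 p1 p2 p3 p4) H =
  H ^+ 3 * pval p0 H - 5 * H ^+ 3 * pval p1 H + (15 * H ^+ 3 - 5 * H ^+ 2) * pval p2 H
  + (15 * H ^+ 2 - 25 * H ^+ 3) * pval p3 H
  + (25 * H ^+ 3 - 25 * H ^+ 2 + 5 * H) * pval p4 H.
Proof. rewrite /recurrence_step !pvalD !pvalZXn; ring. Qed.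

Lemma pval_Poly s H : pval (Poly s) H = foldr (fun a z => z * H + a%:~R) 0 s.
Proof.
rewrite /pval; elim: s => [|a s IHs] /=; first by rewrite rmorph0 horner0.
by rewrite cons_poly_def rmorphD rmorphM /= map_polyX map_polyC hornerD hornerM hornerX hornerC IHs.
Qed.

(** The recurrence is linear over Z[H] and [N] is stable under Z[H], so values known modulo [N]
    propagate from the first five, while [good_step] carries the divisibility along. *)
Lemma recurrence_good (N : K -> Prop) c H (T : nat -> K) :
  (forall g1 g2, N g1 -> N g2 -> N (g1 + g2)) ->
  (forall i g, N g -> N (H ^+ i * g)) ->
  (forall g, N g -> N (- g)) ->
  (forall i, T i.+4.+1 = H ^+ 3 * T i - 5 * H ^+ 3 * T i.+1 + (15 * H ^+ 3 - 5 * H ^+ 2) * T i.+2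
   + (15 * H ^+ 2 - 25 * H ^+ 3) * T i.+3
   + (25 * H ^+ 3 - 25 * H ^+ 2 + 5 * H) * T i.+4) ->
  (forall i, (i < 5)%N -> exists2 p, good c i p & N (T i - pval p H)) ->
  forall i, exists2 p, good c i p & N (T i - pval p H).
Proof.
move=> ND NH NN Trec T0.
have Nn (n : nat) g : N g -> N (n%:R * g).
  have N0 : N g -> N 0 by move=> Ng; rewrite -(subrr g); apply/ND/NN.
  move=> Ng; elim: n => [|n IHn]; first by rewrite mul0r; apply: N0.
  by rewrite -addn1 natrD mulrDl mul1r; apply: ND.
elim/ltn_ind => i IHi; have [/T0 //|i5] := ltnP i 5.
have [j ij] : exists j, i = j.+4.+1 by exists (i - 5)%N; lia.
rewrite ij.
have [|p0 g0 n0] := IHi j; first lia.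
have [|p1 g1 n1] := IHi j.+1; first lia.
have [|p2 g2 n2] := IHi j.+2; first lia.
have [|p3 g3 n3] := IHi j.+3; first lia.
have [|p4 g4 n4] := IHi j.+4; first lia.
exists (recurrence_step p0 p1 p2 p3 p4); first exact: good_step.
rewrite Trec pval_step.
set r0 := T j - _ in n0; set r1 := T j.+1 - _ in n1; set r2 := T j.+2 - _ in n2.
set r3 := T j.+3 - _ in n3; set r4 := T j.+4 - _ in n4.
suff : N (H ^+ 3 * r0 + - (5 * (H ^+ 3 * r1)) + 15 * (H ^+ 3 * r2) + - (5 * (H ^+ 2 * r2))
   + 15 * (H ^+ 2 * r3) + - (25 * (H ^+ 3 * r3)) + 25 * (H ^+ 3 * r4) + - (25 * (H ^+ 2 * r4))
   + 5 * (H ^+ 1 * r4)).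
  congr N; rewrite /r0 /r1 /r2 /r3 /r4; ring.
have NnH (n m : nat) g : N g -> N (n%:R * (H ^+ m * g)) by move=> Ng; apply/Nn/NH.
apply: (ND _ _ _ (NnH 5 1%N _ n4)); apply: (ND _ _ _ (NN _ (NnH 25 2%N _ n4))); apply: (ND _ _ _ (NnH 25 3%N _ n4));
  apply: (ND _ _ _ (NN _ (NnH 25 3%N _ n3))); apply: (ND _ _ _ (NnH 15 2%N _ n3));
  apply: (ND _ _ _ (NN _ (NnH 5 2%N _ n2))); apply: (ND _ _ _ (NnH 15 3%N _ n2));
  apply: (ND _ _ _ (NN _ (NnH 5 3%N _ n1))); exact: NH.
Qed.
End PolyValue.

(** * The series F and G *)

Lemma Fps_smul a b : Fps (smul a b) = Fps a * Fps b.
Proof. by apply/fpsP. Qed.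

Lemma Fps_spow a n : Fps (spow a n) = Fps a ^+ n.
Proof. by elim: n => // n IHn; rewrite exprS -IHn -Fps_smul. Qed.

Lemma Fps_sq a : Fps (sq a) = q * Fps a.
Proof. by apply/fpsP => n; rewrite coefs_qM. Qed.

Definition fps_of_poly (p : {poly int}) : fps int := Fps (fun n => p`_n).

Lemma fps_of_poly_is_zmod_morphism : zmod_morphism fps_of_poly.
Proof. by move=> p r; apply/fpsP => n; rewrite coefsB /= coefB. Qed.
HB.instance Definition _ := GRing.isZmodMorphism.Build {poly int} (fps int)
  fps_of_poly fps_of_poly_is_zmod_morphism.

Lemma fps_of_poly_is_monoid_morphism : monoid_morphism fps_of_poly.
Proof.
split=> [|p r]; apply/fpsP => n; first by rewrite /= coef1.
by rewrite /= coefM.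
Qed.
HB.instance Definition _ := GRing.isMonoidMorphism.Build {poly int} (fps int)
  fps_of_poly fps_of_poly_is_monoid_morphism.

Lemma fps_of_polyXn n : fps_of_poly 'X^n = q ^+ n.
Proof. by apply/fpsP => i; rewrite coefs_qX /= coefXn. Qed.

Lemma Fps_qpoch k : (0 < k)%N -> Fps (qpoch k) = dil k E.
Proof.
move=> k0; apply/fpsP => n.
rewrite (eqm_dil k0 (eqm_euler int (leqnn n)) (ltnSn n)) dil_poch //.
transitivity ((fps_of_poly (\prod_(1 <= m < n.+1) (1 - 'X^(k * m))))`@n) => //.
rewrite rmorph_prod /=; congr (coefs _ n); apply: eq_bigr => m _.
by rewrite rmorphB rmorph1 /= fps_of_polyXn.
Qed.

Lemma qpochinvP k : (0 < k)%N -> Fps (qpochinv k) * dil k E = 1.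
Proof.
move=> k0; pose D n := \prod_(1 <= m < n.+1) \sum_(r < n.+1) q ^+ (k * m * r).
have DE n : (Fps (qpochinv k))`@n = (D n)`@n.
  transitivity ((fps_of_poly (\prod_(1 <= m < n.+1) \sum_(r < n.+1) 'X^(k * m * r)))`@n) => //.
  rewrite rmorph_prod /=; congr (coefs _ n); apply: eq_bigr => m _.
  by rewrite rmorph_sum /=; apply: eq_bigr => r _; rewrite fps_of_polyXn.
have D1 n : eqm n.+1 (D n * dil k (poch int n)) 1.
  rewrite dil_poch // /D -big_split /= big_seq.
  apply: (@eqm_trans _ _ (\prod_(i <- index_iota 1 n.+1 | i \in index_iota 1 n.+1) 1));
    last by rewrite big1.
  apply: eqm_prod => m; rewrite mem_index_iota => /andP[m0 _].
  (* A geometric series cut after n+1 terms, times 1 - q^(km), is 1 - q^(km(n+1)), hence 1 modulo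
     q^(n+1). *)
  rewrite mulrC (_ : _ * _ = 1 - q ^+ (k * m * n.+1) * 1).
    rewrite -[X in eqm _ _ X]subr0 => i ni; rewrite !coefsB; congr (_ - _).
    by apply: (eqm_qX (N := n.+1)) ni; rewrite leq_pmull // muln_gt0 k0.
  rewrite mulr1 (exprM _ (k * m) n.+1) -[RHS]opprB subrX1 -mulNr opprB; congr (_ * _).
  by apply: eq_bigr => r _; rewrite (exprM _ (k * m)).
(* Modulo q^(n+1) both truncations invert the same product, so they agree there. *)
have DD n N : (n <= N)%N -> eqm n.+1 (D n) (D N).
  move=> nN; rewrite -[X in eqm _ X]mulr1 -[X in eqm _ _ X]mul1r.
  apply: (@eqm_trans _ _ (D n * (D N * dil k (poch int N)))).
    by apply: eqmM => //; apply: eqm_sym; apply: (eqm_leq (M := N.+1)) (D1 N).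
  rewrite mulrCA mulrC; apply: eqmM => //.
  apply: (@eqm_trans _ _ (D n * dil k (poch int n))) => //.
  by apply: eqmM => //; apply: eqm_dil => //; apply: eqm_poch.
apply: eqm_eq => N; exists N.+1 => //.
apply: (@eqm_trans _ _ (D N * dil k (poch int N))) => //; apply: eqmM.
  by move=> n nN; rewrite DE; apply: (DD n N nN n).
by apply: eqm_dil => //; apply: eqm_euler.
Qed.

Definition Ff := Fps Fs.
Definition Gf := Fps Gs.

Lemma E_neq0 k : dil k E != 0. Proof. exact/dil_neq0/euler_neq0. Qed.

Lemma dil_gauss k : (0 < k)%N -> dil k Psi * dil k E = dil (k * 2) E ^+ 2.
Proof. by move=> k0; rewrite -rmorphM gauss_triangular rmorphXn /= dil_dil. Qed.

Lemma Gf_psi : Gf * Psi ^+ 2 = q * dil 5 Psi ^+ 2.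
Proof.
have nz : E ^+ 2 * dil 5 E ^+ 2 != 0.
  by rewrite mulf_neq0 // expf_neq0 // ?E_neq0 // -(dil1 E) E_neq0.
apply: (mulIf nz).
transitivity (Gf * (Psi * E) ^+ 2 * dil 5 E ^+ 2); first by ring.
transitivity (q * (dil 5 Psi * dil 5 E) ^+ 2 * E ^+ 2); last by ring.
rewrite dil_gauss // gauss_triangular -[(5 * 2)%N]/10%N /Gf Fps_sq !(Fps_spow, Fps_smul) !Fps_qpoch // dil1.
transitivity (q * E ^+ 2 * dil 10 E ^+ 4 * (Fps (qpochinv 2) * dil 2 E) ^+ 4
  * (Fps (qpochinv 5) * dil 5 E) ^+ 2); first by ring.
by rewrite !qpochinvP // !expr1n; ring.
Qed.

(** Equivalently F = m^2 h with m = E / (q E(q^25)) and h = q^3 psi(q^25) / psi. *)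
Lemma Ff_psi : Ff * Psi * dil 25 E ^+ 2 = q * E ^+ 2 * dil 25 Psi.
Proof.
have nz : E * dil 25 E != 0 by rewrite mulf_neq0 // ?E_neq0 // -(dil1 E) E_neq0.
apply: (mulIf nz).
transitivity (Ff * (Psi * E) * dil 25 E ^+ 3); first by ring.
transitivity (q * E ^+ 3 * (dil 25 Psi * dil 25 E)); last by ring.
rewrite dil_gauss // gauss_triangular -[(25 * 2)%N]/50%N /Ff Fps_sq !(Fps_spow, Fps_smul) !Fps_qpoch // dil1.
transitivity (q * E ^+ 3 * dil 50 E ^+ 2 * (Fps (qpochinv 2) * dil 2 E) ^+ 2
  * (Fps (qpochinv 25) * dil 25 E) ^+ 3); first by ring.
by rewrite !qpochinvP // !expr1n; ring.
Qed.

(** Positivity: once all lower coefficients vanish, the coefficient of q^(2n) is a_n^2 + 3 b_n^2. *)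
Lemma fps_sum_squares (A B : fps int) : A ^+ 2 + 3 * B ^+ 2 = 0 -> A = 0 /\ B = 0.
Proof.
move=> h; suff AB n : A`@n = 0 /\ B`@n = 0.
  by split; apply/fpsP => n; have [] := AB n.
elim/ltn_ind: n => n IHn.
have top (C : fps int) : (forall m, (m < n)%N -> C`@m = 0) -> (C ^+ 2)`@(n + n) = C`@n ^+ 2.
  move=> C0; have nn : (n < (n + n).+1)%N by lia.
  rewrite expr2 coefsM (bigD1 (Ordinal nn)) //= addnK big1 ?addr0 // => i.
  rewrite -val_eqE /= neq_ltn => /orP[/C0->|ni]; first by rewrite mul0r.
  by rewrite [X in _ * X]C0 ?mulr0 //; have := ltn_ord i; lia.
have := congr1 (fun f => f`@(n + n)) h; rewrite coefsD.
have -> : 3 * B ^+ 2 = B ^+ 2 + B ^+ 2 + B ^+ 2 by ring.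
rewrite !coefsD !top ?coefs0 => [s|m /IHn[]//|m /IHn[]//].
have := sqr_ge0 A`@n; have := sqr_ge0 B`@n => b0 a0.
suff [sa sb] : A`@n ^+ 2 = 0 /\ B`@n ^+ 2 = 0 by split; apply/eqP; rewrite -sqrf_eq0 (sa, sb).
by move: (A`@n ^+ 2) (B`@n ^+ 2) s a0 b0 => a b s a0 b0; lia.
Qed.

(** Since 4 (X^2 + XY + Y^2) = (2X + Y)^2 + 3 Y^2, the cofactor of X - Y vanishes only when X = Y =
    0. This extracts the cube root left by the norm identity. *)
Lemma fps_cube_inj (X Y : fps int) : X ^+ 3 = Y ^+ 3 -> X = Y.
Proof.
move=> XY; apply/eqP; rewrite -subr_eq0; have /eqP : (X - Y) * (X ^+ 2 + X * Y + Y ^+ 2) = 0.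
  by transitivity (X ^+ 3 - Y ^+ 3); [ring | rewrite XY subrr].
rewrite mulf_eq0 => /orP[//|/eqP h].
have [h1 h2] : 2 * X + Y = 0 /\ Y = 0.
  apply: fps_sum_squares; transitivity (4 * (X ^+ 2 + X * Y + Y ^+ 2)); first by ring.
  by rewrite h mulr0.
move: h; by rewrite h2 mulr0 expr0n /= !addr0 ?subr0 => /eqP; rewrite sqrf_eq0.
Qed.

(** * Fractions of power series *)

Lemma fq_neq0 : q != 0.
Proof. by apply/eqP => /fpsP/(_ 1%N)/eqP; rewrite /= oner_eq0. Qed.

Lemma psi_neq0 : Psi != 0.
Proof. by apply/eqP => /fpsP/(_ 0%N)/eqP; rewrite /= big_ord_recl big_ord0 /triF. Qed.

Lemma cls0_dil (f : fps int) : cls 0 f -> f = dil 5 (fU f).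
Proof.
move=> cf; apply/fpsP => n /=; case: ifPn => [/dvdnP[m ->]|n5].
  by rewrite mulnK // mulnC.
by apply: cf; rewrite mod0n.
Qed.

Lemma fU_cls r (f : fps int) : (r %% 5 != 0)%N -> cls r f -> fU f = 0.
Proof.
move=> r5 cf; apply/fpsP => n; rewrite [LHS]/=; apply: cf.
by rewrite modnMr eq_sym.
Qed.

Section Field.
Variables (K : fieldType) (iota : {rmorphism fps int -> K}).
Hypothesis iota_inj : injective iota.
Local Notation "f %:F" := (iota f).

Lemma iota_eq (f g : fps int) : (f%:F == g%:F) = (f == g).
Proof. exact: (inj_eq iota_inj). Qed.

Lemma iota_eq0 (f : fps int) : (f%:F == 0) = (f == 0).
Proof. by rewrite -(rmorph0 iota) iota_eq. Qed.

(* Fractions in q^5; [null] collects the elements whose class-0 part vanishes,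
   that is the kernel of U_5 extended to fractions. *)
Definition Vsub (t : K) := exists A B : fps int, B != 0 /\ t = (dil 5 A)%:F / (dil 5 B)%:F.

Definition null (f : K) := exists S D : fps int, [/\ D != 0, f * (dil 5 D)%:F = S%:F & fU S = 0].

Lemma dilF_neq0 k (B : fps int) : B != 0 -> (dil k B)%:F != 0.
Proof. by move=> B0; rewrite iota_eq0 dil_neq0. Qed.

Lemma Vsub1 : Vsub 1.
Proof. by exists 1, 1; rewrite oner_neq0 rmorph1 divff ?iota_eq0 ?oner_neq0. Qed.

Lemma VsubB s t : Vsub s -> Vsub t -> Vsub (s - t).
Proof.
move=> [A [B [B0 ->]]] [C [D [D0 ->]]]; exists (A * D - C * B), (B * D).
split; first by rewrite mulf_neq0.
rewrite !(rmorphB, rmorphM) /=; field.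
by rewrite !dilF_neq0.
Qed.

Lemma VsubM s t : Vsub s -> Vsub t -> Vsub (s * t).
Proof.
move=> [A [B [B0 ->]]] [C [D [D0 ->]]]; exists (A * C), (B * D).
split; first by rewrite mulf_neq0.
rewrite !rmorphM /=; field.
by rewrite !dilF_neq0.
Qed.

Lemma VsubV s : Vsub s -> Vsub s^-1.
Proof.
move=> [A [B [B0 ->]]]; rewrite invf_div; have [->|A0] := eqVneq A 0.
  by exists 0, 1; rewrite oner_neq0 !rmorph0 invr0 mulr0 mul0r.
by exists B, A.
Qed.

Lemma Vsub_dil A : Vsub (dil 5 A)%:F.
Proof. by exists A, 1; rewrite oner_neq0 !rmorph1 divr1. Qed.

Lemma nullD f g : null f -> null g -> null (f + g).
Proof.
move=> [S [D [D0 fD SU]]] [S' [D' [D'0 gD SU']]].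
exists (dil 5 D' * S + dil 5 D * S'), (D * D'); split; first by rewrite mulf_neq0.
  by rewrite !(rmorphM, rmorphD) /= -fD -gD; ring.
by rewrite fUD !fU_dilM SU SU' !mulr0 addr0.
Qed.

Lemma nullZ t f : Vsub t -> null f -> null (t * f).
Proof.
move=> [A [B [B0 ->]]] [S [D [D0 fD SU]]]; exists (dil 5 A * S), (B * D); split.
- by rewrite mulf_neq0.
- by rewrite !rmorphM /= -fD; field; rewrite dilF_neq0.
- by rewrite fU_dilM SU mulr0.
Qed.

(** The denominator in q^5 passes through U_5 and cancels there; this turns congruences modulo
    [null] back into identities of series. *)
Lemma nullF S : null S%:F -> fU S = 0.
Proof.
move=> [S' [D [D0 SD SU]]].
have SDe : S' = dil 5 D * S by apply/eqP; rewrite -iota_eq -SD rmorphM mulrC.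
by move: SU; rewrite SDe fU_dilM => /eqP; rewrite mulf_eq0 (negPf D0) => /eqP.
Qed.

Lemma null_exp (e2 : fps int) e : cls 2 e2 -> (0 < e < 5)%N ->
  null ((e2%:F / (- (q * dil 25 E))%:F) ^+ e).
Proof.
(* Multiplying rho by q^5 E(q^25), a series in q^5, leaves -q^4 e2, of class 6; the e-th power has
   class 6e, nonzero modulo 5. *)
move=> c2 e5; exists ((- (q ^+ 4 * e2)) ^+ e), ((q * dil 5 E) ^+ e); split.
- by rewrite expf_neq0 // mulf_neq0 ?fq_neq0 ?E_neq0.
- have qn : q%:F != 0 by rewrite iota_eq0 fq_neq0.
  have En : (dil 25 E)%:F != 0 by rewrite iota_eq0 E_neq0.
  rewrite !rmorphXn -exprMn; congr (_ ^+ _).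
  rewrite !rmorphM /= dil_q // dil_dil // !rmorphN !(rmorphXn, rmorphM) /=.
  by field; rewrite oppr_eq0 mulf_neq0 // En qn.
apply: (fU_cls (r := 6 * e)); first by clear -e5; lia.
have cS : cls 6 (- (q ^+ 4 * e2)).
  by move=> n n6; rewrite coefsN (clsM (@cls_qX int 4) c2) ?oppr0.
elim: e {e5} => [|e IHe]; first by rewrite muln0; move=> n n0; rewrite coefs1; case: n n0.
by rewrite mulnS exprS; apply: clsM.
Qed.

Lemma modular_setup : exists rho k : K,
  let x := rho ^+ 2 * (1 + k) / k in let y := (1 - k) / rho ^+ 2 in
  let H := (dil 5 Gf)%:F in
  [/\ [/\ Vsub k, forall e, (0 < e < 5)%N -> null (rho ^+ e), rho != 0 & k != 0],
      [/\ 1 + k != 0, 1 - k != 0, 1 + k - k ^+ 2 != 0 & rho ^+ 5 * (1 + k) ^+ 2 = k * (1 - k) ^+ 2],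
      H = k / (1 + k - k ^+ 2) /\ H^-1 ^+ 3 = 1 + x ^+ 5 + y ^+ 5 + 5 * x ^+ 2 * y ^+ 2 - 5 * x * y,
      Psi%:F = (q ^+ 3 * dil 25 Psi)%:F * (1 + x + y) &
      E%:F = (q * dil 25 E)%:F * (rho^-1 - 1 - rho)].
Proof.
have [e0 [e2 [a [b [[c0 c2 ca cb] [Ee Pe] He Hc [R0 R1 R2 R3]]]]]] := dissection_relations.
move: Ee Pe He Hc R0 R1 R2 R3.
set e1 := - _; set c := q ^+ 3 * _ => Ee Pe He Hc R0 R1 R2 R3.
have e1n : e1 != 0 by rewrite oppr_eq0 mulf_neq0 ?fq_neq0 ?E_neq0.
have e2n : e2 != 0.
  by apply: contraNneq e1n => e20; move/eqP: He; rewrite e20 mulr0 eq_sym oppr_eq0 sqrf_eq0.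
have cn : c != 0 by rewrite mulf_neq0 ?expf_neq0 ?fq_neq0 ?dil_neq0 ?psi_neq0.
have cc : cls 3 c.
  apply: (cls_mod (r := 3 + 0)) => //.
  by apply: clsM; [apply: cls_qX | rewrite -(@dil_dil _ 5 5) //; apply: cls_dil5].
have c1 : cls 1 e1.
  move=> n n1; rewrite coefsN -(@dil_dil _ 5 5) //.
  by rewrite (clsM (@cls_qX int 1) (cls_dil5 (dil 5 E))) ?oppr0.
have d1n : dil 2 e1 != 0 by rewrite dil_neq0.
have d2n : dil 2 e2 != 0 by rewrite dil_neq0.
have Hd : dil 2 e0 * dil 2 e2 = - dil 2 e1 ^+ 2.
  by rewrite -rmorphM He rmorphN rmorphXn.
have FP : (e1%:F != 0) * (e2%:F != 0) * ((dil 2 e1)%:F != 0) * ((dil 2 e2)%:F != 0) * (c%:F != 0).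
  by rewrite !iota_eq0.
move: FP => [[[[F1 F2] F3] F4] F5].
have tF (f g : fps int) : f = g -> f%:F = g%:F by move->.
have [] := @dissection_parametrization K e0%:F e1%:F e2%:F (dil 2 e0)%:F (dil 2 e1)%:F
   (dil 2 e2)%:F a%:F b%:F c%:F F1 F2 F3 F4.
- by rewrite -rmorphM He rmorphN rmorphXn.
- by rewrite -rmorphM Hd rmorphN rmorphXn.
- by rewrite -rmorphM Hc rmorphN rmorphXn.
- by rewrite -!rmorphM -rmorphD R0 rmorphXn.
- by rewrite -!rmorphM -rmorphD R1 !rmorphM rmorph_nat.
- by rewrite -!rmorphM -rmorphD R2 !rmorphM rmorph_nat.
- by rewrite -!rmorphM -rmorphD R3 rmorphXn.
set rho := e2%:F / e1%:F; set sigma := (dil 2 e2)%:F / _; set k := rho * _.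
move=> X Y rho5 EE.
have rn : rho != 0 by rewrite mulf_neq0 ?invr_neq0.
have sn : sigma != 0 by rewrite mulf_neq0 ?invr_neq0.
have kn : k != 0 by rewrite mulf_neq0 ?expf_neq0.
have n2 : (2 : K) != 0.
  rewrite -(rmorph_nat iota) iota_eq0.
  by apply/eqP => /fpsP/(_ 0%N).
(* For k = -1 or k = 1 exactly one side of [rho5] would vanish, as 2 is nonzero in [K]. *)
have k1 : 1 + k != 0.
  apply/eqP => k1; have k0 : k = -1 by apply/eqP; rewrite -subr_eq0 opprK addrC k1.
  have /eqP := rho5; rewrite k1 expr0n /= mulr0 eq_sym mulf_eq0 (negPf kn) /= sqrf_eq0.
  by rewrite k0 opprK -[1 + 1]/(2 : K) (negPf n2).
have k2 : 1 - k != 0.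
  apply/eqP => k2; have k0 : k = 1 by apply/eqP; rewrite eq_sym -subr_eq0 k2.
  have /eqP := rho5; rewrite k2 expr0n /= mulr0 mulf_eq0 expf_eq0 /= (negPf rn) /= sqrf_eq0.
  by rewrite k0 -[1 + 1]/(2 : K) (negPf n2).
(* Numerator and denominator have classes 2+4+4 and 1+2+2, both 0 modulo 5, so k is a fraction in
   q^5. *)
have kAB : k = (e2 * dil 2 e2 ^+ 2)%:F / (e1 * dil 2 e1 ^+ 2)%:F.
  by rewrite /k /rho /sigma !(rmorphXn, rmorphM) /=; field; rewrite F1 F3.
set A := e2 * _ in kAB; set B := e1 * _ in kAB.
have cA : cls 0 A.
  have d2 : cls 4 (dil 2 e2) by apply: cls_mod (cls_dil2 c2).
  by rewrite /A expr2; apply: (cls_mod _ (clsM c2 (clsM d2 d2))).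
have cB : cls 0 B.
  have d1 : cls 2 (dil 2 e1) by apply: cls_mod (cls_dil2 c1).
  by rewrite /B expr2; apply: (cls_mod _ (clsM c1 (clsM d1 d1))).
have Bn : B != 0 by rewrite mulf_neq0 // expf_neq0.
clearbody A B.
have BF : B%:F != 0 by rewrite iota_eq0.
have Vk : Vsub k.
  exists (fU A), (fU B); rewrite -!cls0_dil //; split=> //.
  by apply: contraNneq Bn => B0; rewrite (cls0_dil cB) B0 rmorph0.
have G5 : dil 5 Gf * dil 5 Psi ^+ 2 = q ^+ 5 * dil 25 Psi ^+ 2.
  by have := congr1 (dil 5) Gf_psi; rewrite !(rmorphXn, rmorphM) /= dil_q // dil_dil.
set H := (dil 5 Gf)%:F.
have P5n : (dil 5 Psi)%:F != 0 by rewrite dilF_neq0 // psi_neq0.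
have P25n : (dil 25 Psi)%:F != 0 by rewrite dilF_neq0 // psi_neq0.
have qn : q%:F != 0 by rewrite iota_eq0 fq_neq0.
have HE : H = q%:F ^+ 5 * (dil 25 Psi)%:F ^+ 2 / (dil 5 Psi)%:F ^+ 2.
  apply: (mulIf (expf_neq0 2 P5n)); rewrite divfK ?expf_neq0 //.
  by have /tF := G5; rewrite !(rmorphXn, rmorphM).
have Hn : H != 0 by rewrite HE !mulf_neq0 ?invr_neq0 ?expf_neq0.
have cF : c%:F = q%:F ^+ 3 * (dil 25 Psi)%:F by rewrite rmorphM rmorphXn.
pose x := rho ^+ 2 * (1 + k) / k; pose y := (1 - k) / rho ^+ 2.
have norm : H^-1 ^+ 3 = 1 + x ^+ 5 + y ^+ 5 + 5 * x ^+ 2 * y ^+ 2 - 5 * x * y.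
  rewrite -/x in X; rewrite -/y in Y; rewrite -X -Y.
  have := psi_norm_form ca cb cc Pe => /tF.
  rewrite !(rmorph_nat, rmorphXn, rmorphM, rmorphB, rmorphD) /= => NF.
  transitivity ((dil 5 Psi)%:F ^+ 6 / (c%:F ^+ 5 * (dil 25 Psi)%:F)).
    by rewrite HE cF; field; rewrite P5n P25n qn.
  by rewrite -NF cF; field; rewrite P25n qn.
(* By [rho5], x^5, y^5 and xy are rational functions of k alone; this identifies H^-3 with ((1 + k -
   k^2) / k)^3. *)
have xv : x ^+ 5 = (1 - k) ^+ 4 * (1 + k) / k ^+ 3.
  transitivity ((rho ^+ 5 * (1 + k) ^+ 2) ^+ 2 * (1 + k) / k ^+ 5); first by rewrite /x; field.
  by rewrite rho5; field.
have yv : y ^+ 5 = (1 - k) * (1 + k) ^+ 4 / k ^+ 2.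
  transitivity ((1 - k) ^+ 5 * (1 + k) ^+ 4 / (rho ^+ 5 * (1 + k) ^+ 2) ^+ 2).
    by rewrite /y; field; rewrite rn k1.
  by rewrite rho5; field; rewrite kn k2.
have xyv : x * y = (1 - k ^+ 2) / k by rewrite /x /y; field; rewrite rn kn.
have cube : H^-1 ^+ 3 = ((1 + k - k ^+ 2) / k) ^+ 3.
  rewrite norm xv yv.
  transitivity (1 + (1 - k) ^+ 4 * (1 + k) / k ^+ 3 + (1 - k) * (1 + k) ^+ 4 / k ^+ 2
    + 5 * (x * y) ^+ 2 - 5 * (x * y)); first by ring.
  by rewrite xyv; field.
(* A general field may contain nontrivial cube roots of unity, so the cube root is taken on integer
   series: k = A / B clears the denominators and [fps_cube_inj] applies. *)
have HAB : dil 5 Gf * (B ^+ 2 + A * B - A ^+ 2) = A * B.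
  apply: fps_cube_inj; apply/eqP; rewrite -iota_eq; apply/eqP.
  have AF : A%:F = k * B%:F by rewrite kAB divfK.
  rewrite !(rmorphXn, rmorphM, rmorphB, rmorphD) /= AF -/H.
  transitivity (H ^+ 3 * B%:F ^+ 6 * k ^+ 3 * ((1 + k - k ^+ 2) / k) ^+ 3); first by field.
  by rewrite -cube; field.
have AF : A%:F = k * B%:F by rewrite kAB divfK.
have HK : H * (1 + k - k ^+ 2) = k.
  apply: (mulIf (expf_neq0 2 BF)); move/tF: HAB.
  rewrite !(rmorphXn, rmorphM, rmorphB, rmorphD) /= AF -/H => HAB.
  by transitivity (H * (B%:F ^+ 2 + k * B%:F * B%:F - (k * B%:F) ^+ 2)); [ring | rewrite HAB; ring].
have kH : 1 + k - k ^+ 2 != 0.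
  by apply: contraNneq kn => kH; rewrite -HK kH mulr0.
exists rho, k => /=; split.
- by split=> // e e5; apply: null_exp.
- by [].
- by split=> //; apply: (mulIf kH); rewrite divfK.
- by rewrite {1}Pe !rmorphD -X -Y cF; field; rewrite P25n qn.
- have -> : (q * dil 25 E)%:F = - e1%:F by rewrite /e1 rmorphN opprK.
  by rewrite {1}Ee !rmorphD /= EE; ring.
Qed.
End Field.

Lemma rmorph_pval (R S : comNzRingType) (phi : {rmorphism R -> S}) p x :
  phi (pval p x) = pval p (phi x).
Proof.
rewrite /pval -horner_map -map_poly_comp; congr (_.[_]).
by apply: eq_map_poly => z /=; rewrite rmorph_int.
Qed.

Lemma pvalE (R : comNzRingType) p (x : R) : pval p x = \sum_(j < size p) (p`_j)%:~R * x ^+ j.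
Proof.
rewrite /pval (horner_coef_wide _ (size_poly _ _)).
by apply: eq_bigr => j _; rewrite coef_map.
Qed.

Lemma pvalZ (R : comNzRingType) a p (x : R) : pval (a *: p) x = a%:~R * pval p x.
Proof. by rewrite /pval linearZ hornerZ. Qed.

Lemma pval_sum (R : comNzRingType) n (F : nat -> {poly int}) (x : R) :
  pval (\sum_(j < n) F j) x = \sum_(j < n) pval (F j) x.
Proof.
by elim: n => [|n IHn]; rewrite ?big_ord0 ?big_ord_recr /= ?pvalD ?IHn // /pval rmorph0 horner0.
Qed.

Lemma coefs_intM (z : int) (f : fps int) n : (z%:~R * f)`@n = z * f`@n.
Proof. by rewrite -(rmorph_int (@fconst int)) coefs_constM intz. Qed.

Lemma Gf_neq0 : Gf != 0.
Proof.
apply/eqP => G0; have := Gf_psi; rewrite G0 mul0r => /eqP; apply/negP.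
by rewrite eq_sym mulf_neq0 ?fq_neq0 // expf_neq0 // dil_neq0 // psi_neq0.
Qed.

Lemma coefs0_pval p : (pval p Gf)`@0 = p`_0.
Proof.
elim/poly_ind: p => [|p c _]; first by rewrite /pval rmorph0 horner0 coef0.
rewrite /pval rmorphD rmorphM /= map_polyX map_polyC hornerMXaddC coefsD coefsM0 mulr0 add0r.
by rewrite coefD coefMX coefC add0r -[X in X`@0]mulr1 coefs_intM mulr1.
Qed.

Lemma peval_pval p n : peval p Gs n = (pval p Gf)`@n.
Proof.
rewrite pvalE coefs_sum; apply: eq_bigr => j _.
by rewrite coefs_intM -[Gf ^+ j]Fps_spow.
Qed.

Section Field.
Variables (K : fieldType) (iota : {rmorphism fps int -> K}).
Hypothesis iota_inj : injective iota.
Local Notation "f %:F" := (iota f).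
Local Notation null := (null iota).
Local Notation Vsub := (Vsub iota).
Local Notation H := (dil 5 Gf)%:F.

Lemma nullN f : null f -> null (- f).
Proof.
move=> nf; rewrite -mulN1r -(rmorphN1 iota) -(rmorphN1 (dil 5)).
by apply: nullZ => //; apply: Vsub_dil.
Qed.

Lemma nullH i f : null f -> null (H ^+ i * f).
Proof. by move=> nf; rewrite -!rmorphXn; apply: nullZ => //; apply: Vsub_dil. Qed.

(** Applying U_5 to the congruence gives G^(j+2) U_5(X) = p(G). For i > 2j+3 the first j+2
    coefficients of p vanish, and the power of G divides out. *)
Lemma fU_extract c i j p (X : fps int) : (2 * j + 3 < i)%N -> good c i p ->
  null (X%:F * H ^+ (j + 2) - pval p H) ->
  exists2 p' : {poly int}, forall n, ((5 ^ ((5 * (n + (j + 2)) + c - 3 * i) %/ 6))%:Z %| p'`_n)%Z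
    & fU X = pval p' Gf.
Proof.
move=> ij gp.
have -> : X%:F * H ^+ (j + 2) - pval p H = (dil 5 (Gf ^+ (j + 2)) * X - dil 5 (pval p Gf))%:F.
  rewrite rmorphB rmorphM (rmorph_pval (dil 5)) (rmorph_pval iota) /=.
  by rewrite mulrC (rmorphXn (dil 5)) (rmorphXn iota).
move=> /(nullF iota_inj); rewrite fUD fUN fU_dilM fU_dil => /eqP; rewrite subr_eq0 => /eqP Ue.
exists (drop_poly (j + 2) p) => [n|].
  by rewrite coef_drop_poly; have [] := gp (n + (j + 2))%N.
apply: (mulfI (expf_neq0 (j + 2) Gf_neq0)); rewrite Ue.
rewrite -{1}(poly_take_drop (j + 2) p) (_ : take_poly _ _ = 0) ?add0r.
  by rewrite -['X^_]mul1r -[X in _ * X]mul1r /pval !rmorphM /= rmorph1 mul1r mul1r map_polyXn hornerM hornerXn mulrC.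
apply/polyP => n; rewrite coef_take_poly coef0; case: ltnP => // nj.
by have [-> //] := gp n; lia.
Qed.

Lemma fU_powers : (forall j, exists2 p : {poly int}, forall n, ((5 ^ ((5 * n - j.+1) %/ 6))%:Z %| p`_n)%Z
    & fU (Gf ^+ j) = pval p Gf)
  /\ (forall j, exists2 p : {poly int}, forall n, ((5 ^ ((5 * n + 2 - j) %/ 6))%:Z %| p`_n)%Z
    & fU (Ff * Gf ^+ j) = pval p Gf).
Proof.
have [rho [k [[Vk Nrho rn kn] [k1 k2 kH rho5] [HE norm] PE EE]]] := modular_setup iota_inj.
have V1 := Vsub1 iota_inj; have VB := VsubB iota_inj; have VM := VsubM iota_inj.
have VV := @VsubV K iota; have ND := @nullD K iota; have NZ := nullZ iota_inj.
have NN := nullN; have NH := nullH.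
have UP := w_powers V1 VB VM VV Vk ND NZ Nrho rn kn k1 k2 kH rho5.
have MP := m2_w_powers V1 VB VM VV Vk ND NZ Nrho rn kn k1 k2 kH rho5.
rewrite -HE in UP MP.
pose x := rho ^+ 2 * (1 + k) / k; pose y := (1 - k) / rho ^+ 2.
rewrite -/x -/y in norm PE UP MP.
set w := 1 + x + y in PE UP MP; set m := rho^-1 - 1 - rho in EE MP.
have iz (f : fps int) : f != 0 -> f%:F != 0 by rewrite iota_eq0.
have Hn : H != 0 by rewrite iz // dil_neq0 // Gf_neq0.
have wn : w != 0.
  by apply: contraNneq (iz _ psi_neq0) => w0; rewrite PE w0 mulr0.
have u1 : H^-1 = x * y + 1 by rewrite HE /x /y; field; rewrite rn kn kH.
have hrec := h_recurrence Hn wn u1 norm.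
rewrite -/w in hrec; set h := w^-1 in hrec.
have hw : h * w = 1 by rewrite mulVf.
have q0 := iz _ fq_neq0; have P25 := iz _ (dil_neq0 25 psi_neq0).
(* With G = q psi(q^5)^2 / psi^2, the factor psi(q^5)^2 cancels in G(q) G(q^5). *)
have GH : Gf%:F * H = h ^+ 2.
  have n5 := iz _ (dil_neq0 5 psi_neq0).
  have G1 := congr1 iota Gf_psi; have G5 := congr1 (fun f => iota (dil 5 f)) Gf_psi.
  move: G1 G5; rewrite /= !(rmorphXn, rmorphM) /= dil_q // dil_dil // PE !(rmorphXn, rmorphM).
  move=> G1 G5.
  have nz : w ^+ 2 * q%:F ^+ 6 * (dil 25 Psi)%:F ^+ 2 * (dil 5 Psi)%:F ^+ 2 != 0.
    by rewrite !mulf_neq0 ?expf_neq0.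
  apply: (mulIf nz).
  transitivity ((Gf%:F * (q%:F ^+ 3 * (dil 25 Psi)%:F * w) ^+ 2) * (H * (dil 5 Psi)%:F ^+ 2)).
    by ring.
  by rewrite G1 G5 /h; field.
have Fm : Ff%:F = m ^+ 2 * h.
  have E25 := iz _ (E_neq0 25).
  have F1 := congr1 iota Ff_psi; move: F1; rewrite !(rmorphXn, rmorphM) /= PE EE !(rmorphXn, rmorphM).
  move=> F1; have nz : q%:F ^+ 3 * (dil 25 Psi)%:F * w * (dil 25 E)%:F ^+ 2 != 0.
    by rewrite !mulf_neq0 ?expf_neq0.
  by apply: (mulIf nz); rewrite mulrA F1 /h; field.
(* As hw = 1, this is f h^(i-4) H^2, the normalization used in [good]: w^4 reaches the exponent -4
   and H^2 clears 1/H^2 from the starting values. *)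
pose T f i := f * h ^+ i * w ^+ 4 * H ^+ 2.
have Trec f i : T f i.+4.+1 = H ^+ 3 * T f i - 5 * H ^+ 3 * T f i.+1
   + (15 * H ^+ 3 - 5 * H ^+ 2) * T f i.+2 + (15 * H ^+ 2 - 25 * H ^+ 3) * T f i.+3
   + (25 * H ^+ 3 - 25 * H ^+ 2 + 5 * H) * T f i.+4.
  rewrite /T (_ : h ^+ i.+4.+1 = h ^+ i * h ^+ 5); last by rewrite -exprD addnS addn4.
  by rewrite hrec !exprS; ring.
have Tj f i d : (i + d = 4)%N -> T f i = H ^+ 2 * (f * w ^+ d).
  move=> id4; rewrite /T (_ : w ^+ 4 = w ^+ i * w ^+ d); last by rewrite -exprD id4.
  transitivity (H ^+ 2 * (f * ((h ^+ i * w ^+ i) * w ^+ d))); first by ring.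
  by rewrite -exprMn hw expr1n mul1r.
have PV s f t g : null g -> H ^+ 2 * f - t = H ^+ 2 * g -> pval (Poly s) H = t -> null (H ^+ 2 * f - pval (Poly s) H).
  by move=> ng fg ->; rewrite fg; apply: NH.
(* The polynomials are those of [w_powers] times H^2. The constant 1 is the largest possible: at i =
   0 the coefficient -5 of H^2 requires (10 + c)/6 < 2. *)
have U0 i : (i < 5)%N -> exists2 p, good 1 i p & null (T 1 i - pval p H).
  case: i => [|[|[|[|[|//]]]]] _; have [N4 N3 N2 N1 N0] := UP.
  - exists (Poly [:: 6; 0; -5]); first exact: goodP.
    rewrite (Tj _ _ 4%N) //; apply: (PV _ _ _ _ N4 _ (pval_Poly _ _)) => /=.
    by field.
  - exists (Poly [:: 0; 6; -5]); first exact: goodP.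
    rewrite (Tj _ _ 3%N) //; apply: (PV _ _ _ _ N3 _ (pval_Poly _ _)) => /=.
    by field.
  - exists (Poly [:: 0; 2; -1]); first exact: goodP.
    rewrite (Tj _ _ 2%N) //; apply: (PV _ _ _ _ N2 _ (pval_Poly _ _)) => /=.
    by field.
  - exists (Poly [:: 0; 0; 1]); first exact: goodP.
    rewrite (Tj _ _ 1%N) //; apply: (PV _ _ _ _ N1 _ (pval_Poly _ _)) => /=.
    by field.
  - exists (Poly [:: 0; 0; 1]); first exact: goodP.
    rewrite (Tj _ _ 0%N) //; apply: (PV _ _ _ _ N0 _ (pval_Poly _ _)) => /=.
    by field.
(* Likewise from [m2_w_powers]. The constant 7 is again the largest possible: at i = 0 the
   coefficient -25 of H^2 requires (10 + c)/6 < 3. *)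
have V0 i : (i < 5)%N -> exists2 p, good 7 i p & null (T (m ^+ 2) i - pval p H).
  case: i => [|[|[|[|[|//]]]]] _; have [N4 N3 N2 N1 N0] := MP.
  - exists (Poly [:: 0; 0; -25]); first exact: goodP.
    rewrite (Tj _ _ 4%N) //; apply: (PV _ _ _ _ N4 _ (pval_Poly _ _)) => /=.
    by field.
  - exists (Poly [:: 1; 5; -25]); first exact: goodP.
    rewrite (Tj _ _ 3%N) //; apply: (PV _ _ _ _ N3 _ (pval_Poly _ _)) => /=.
    by field.
  - exists (Poly [:: 0; 0; -5]); first exact: goodP.
    rewrite (Tj _ _ 2%N) //; apply: (PV _ _ _ _ N2 _ (pval_Poly _ _)) => /=.
    by field.
  - exists (Poly [:: 0; 1]); first exact: goodP.
    rewrite (Tj _ _ 1%N) //; apply: (PV _ _ _ _ N1 _ (pval_Poly _ _)) => /=.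
    by field.
  - exists (Poly [:: 0; 0; -1]); first exact: goodP.
    rewrite (Tj _ _ 0%N) //; apply: (PV _ _ _ _ N0 _ (pval_Poly _ _)) => /=.
    by field.
split=> j.
(* By G H = h^2, G^j H^(j+2) is h^(2j) H^2, the value at i = 2j+4; then 5(n+j+2) + 1 - 3i = 5n - j -
   1. *)
- have [p gp np] := recurrence_good ND NH NN (Trec 1) U0 (2 * j + 4)%N.
  have [||p' p'd Ue] := @fU_extract _ _ j _ (Gf ^+ j) _ gp; first lia.
    move: np; congr (null (_ - _)); rewrite /T exprD exprM -GH exprMn !(rmorphXn iota) exprD.
    transitivity (Gf%:F ^+ j * H ^+ j * (h * w) ^+ 4 * H ^+ 2); first by ring.
    by rewrite hw expr1n; ring.
  by exists p' => // n; have := p'd n; congr (is_true (dvdz _ _)); congr (Posz (_ ^ (_ %/ _))); lia.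
(* With F = m^2 h, F G^j H^(j+2) is m^2 h^(2j+1) H^2, so i = 2j+5 and 5(n+j+2) + 7 - 3i = 5n + 2 -
   j. *)
- have [p gp np] := recurrence_good ND NH NN (Trec (m ^+ 2)) V0 (2 * j + 5)%N.
  have [||p' p'd Ue] := @fU_extract _ _ j _ (Ff * Gf ^+ j) _ gp; first lia.
    move: np; congr (null (_ - _)); rewrite /T exprD exprM -GH exprMn rmorphM !(rmorphXn iota) exprD Fm.
    transitivity (m ^+ 2 * h * Gf%:F ^+ j * H ^+ j * (h * w) ^+ 4 * H ^+ 2); first by ring.
    by rewrite hw expr1n; ring.
  by exists p' => // n; have := p'd n; congr (is_true (dvdz _ _)); congr (Posz (_ ^ (_ %/ _))); lia.
Qed.
End Field.

(** * Divisibility of the coefficients of L *)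

Lemma fU_intM z (f : fps int) : fU (z%:~R * f) = z%:~R * fU f.
Proof. by rewrite -(rmorph_int (dil 5)) fU_dilM rmorph_int. Qed.

Lemma fU_sum n (F : nat -> fps int) : fU (\sum_(j < n) F j) = \sum_(j < n) fU (F j).
Proof.
by elim: n => [|n IHn]; [rewrite !big_ord0; apply/fpsP | rewrite !big_ord_recr /= fUD IHn].
Qed.

Lemma fU_pval (f : fps int) (t : nat -> {poly int}) (p : {poly int}) :
  (forall j, fU (f * Gf ^+ j) = pval (t j) Gf) ->
  fU (f * pval p Gf) = pval (\sum_(j < size p) p`_j *: t j) Gf.
Proof.
move=> ft; rewrite [pval p Gf]pvalE mulr_sumr (fU_sum _ (fun j => f * ((p`_j)%:~R * Gf ^+ j))).
rewrite (pval_sum _ (fun j => p`_j *: t j)); apply: eq_bigr => j _.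
by rewrite mulrCA fU_intM ft pvalZ.
Qed.

Lemma dvd_transfer (A B : nat -> nat) (v : nat -> nat -> nat) (t : nat -> {poly int}) p :
  (forall j m, ((5 ^ v j m)%:Z %| (t j)`_m)%Z) ->
  (forall j m, (0 < j)%N -> (0 < m)%N -> (B m <= A j + v j m)%N) ->
  p`_0 = 0 -> (forall j, (0 < j)%N -> ((5 ^ A j)%:Z %| p`_j)%Z) ->
  forall m, (0 < m)%N -> ((5 ^ B m)%:Z %| (\sum_(j < size p) p`_j *: t j)`_m)%Z.
Proof.
move=> tv AB p0 pA m m0; rewrite coef_sum; apply: rpred_sum => -[[|j] jp] _ /=.
  by rewrite p0 scale0r coef0 dvdz0.
rewrite coefZ; apply: (@dvdz_trans ((5 ^ (A j.+1 + v j.+1 m))%:Z)).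
  by apply: dvdn_exp2l; apply: AB.
by rewrite expnD PoszM; apply: dvdz_mul; [apply: pA | apply: tv].
Qed.

Definition represents (A : nat -> nat) nu (p : {poly int}) :=
  [/\ p`_0 = 0, forall j, (0 < j)%N -> ((5 ^ A j)%:Z %| p`_j)%Z & Fps (L nu) = pval p Gf].

Lemma L_after_even n : Fps (L (2 * n).+1) = fU (Ff * Fps (L (2 * n))).
Proof.
have -> : L (2 * n).+1 = if odd (2 * n) then U5 (L (2 * n)) else U5 (smul Fs (L (2 * n))) by [].
by rewrite oddM -Fps_smul.
Qed.

Lemma L_after_odd n : Fps (L (2 * n).+2) = fU (Fps (L (2 * n).+1)).
Proof.
set m := (2 * n).+1.
have -> : L m.+1 = if odd m then U5 (L m) else U5 (smul Fs (L m)) by [].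
by rewrite /m oddS oddM.
Qed.

Lemma represents_transfer A B v (t : nat -> {poly int}) f nu mu p :
  (forall j m, ((5 ^ v j m)%:Z %| (t j)`_m)%Z) ->
  (forall j, fU (f * Gf ^+ j) = pval (t j) Gf) ->
  (forall j m, (0 < j)%N -> (0 < m)%N -> (B m <= A j + v j m)%N) ->
  Fps (L mu) = fU (f * Fps (L nu)) ->
  represents A nu p -> exists p', represents B mu p'.
Proof.
move=> tv ft AB LL [p0 pA Lp]; exists (\sum_(j < size p) p`_j *: t j).
have Lmu : Fps (L mu) = pval (\sum_(j < size p) p`_j *: t j) Gf by rewrite LL Lp (fU_pval p ft).
split=> //; last exact: dvd_transfer AB p0 pA.
(* G has no constant term, so the constant coefficient of the polynomial is the coefficient of q^0,
   which U_5 preserves and which vanishes because p_0 = 0. *)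
by rewrite -coefs0_pval -Lmu LL Lp -[LHS]/((f * pval p Gf)`@0) coefsM0 coefs0_pval p0 mulr0.
Qed.

(** The exponent grows with j because the bound (5m+2-j)/6 for F G^j under U_5 rounds to 0 at m = 1,
    j >= 2; there the new factor 5 has to come from l_j itself. *)
Lemma L_odd_represents alpha :
  exists p, represents (fun j => alpha.+1 + (5 * j - 5) %/ 6)%N (2 * alpha).+1 p.
Proof.
have iota_inj : injective (@FracField.tofrac (fps int)).
  by move=> f g /eqP; rewrite tofrac_eq => /eqP.
have [UG UFG] := fU_powers iota_inj.
have UG' j : exists p : {poly int}, (forall n, ((5 ^ ((5 * n - j.+1) %/ 6))%:Z %| p`_n)%Z)
    /\ fU (1 * Gf ^+ j) = pval p Gf.
  by have [p ? ?] := UG j; exists p; rewrite mul1r.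
have [t tP] := choice UG'.
have UFG' j : exists p : {poly int}, (forall n, ((5 ^ ((5 * n + 2 - j) %/ 6))%:Z %| p`_n)%Z)
    /\ fU (Ff * Gf ^+ j) = pval p Gf.
  by have [p ? ?] := UFG j; exists p.
have [s sP] := choice UFG'.
elim: alpha => [|alpha [p rp]].
  (* L_1 is the image of F, the case j = 0, and (5n+2)/6 is at least 1 + (5n-5)/6. *)
  have [s0 Us0] := sP 0%N; exists (s 0%N).
  have L1 : Fps (L 1) = pval (s 0%N) Gf.
    by rewrite -Us0 (L_after_even 0) expr0; congr (fU (_ * _)); apply/fpsP.
  split=> //.
    by rewrite -coefs0_pval -L1 (L_after_even 0) -[LHS]/((Ff * Fps (L 0))`@0) coefsM0 mul0r.
  by move=> j j0; apply: dvdz_trans (s0 j); apply: dvdn_exp2l; lia.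
have [||p' rp'] := @represents_transfer _ (fun j => alpha.+1 + (5 * j - 3) %/ 6)%N _ t 1 _ (2 * alpha).+2 p
   (fun j => (tP j).1) (fun j => (tP j).2) _ _ rp.
(* Tight at j = 2, where both sides reduce to alpha + 1 + (5m-3)/6. *)
- by move=> j m j0 m0; lia.
- by rewrite mul1r L_after_odd.
have e2 : (2 * alpha).+2 = (2 * alpha.+1)%N by lia.
rewrite e2 in rp'.
apply: (represents_transfer (fun j => (sP j).1) (fun j => (sP j).2) _ (L_after_even _) rp').
(* Tight at j = 1: there (5m+1)/6 = 1 + (5m-5)/6 supplies the new factor 5. *)
by move=> j m j0 m0; lia.
Qed.

Theorem theorem2p1 (alpha : nat) :
  exists p : {poly int},
    p`_0 = 0 /\
    (forall j : nat, ((5 ^ alpha.+1)%:Z %| p`_j)%Z) /\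
    (forall n : nat, L (2 * alpha + 1) n = peval p Gs n).
Proof.
have [p [p0 pA Lp]] := L_odd_represents alpha; exists p; split=> //; split=> [j|n].
  case: j => [|j]; first by rewrite p0 dvdz0.
  by apply: dvdz_trans (pA j.+1 isT); apply: dvdn_exp2l; apply: leq_addr.
by rewrite addn1 peval_pval -Lp.
Qed.
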